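(* Let $(R,\mathfrak{m})$ be a commutative Noetherian local ring and $M$ a Cohen-Macaulay $R$-module. Suppose that for any ideal $\mathfrak{a}$ of $R$, with $t=\operatorname{grade}(\mathfrak{a},M)$, the module $\operatorname{Hom}_R(R/\mathfrak{a},H^{t+1}_{\mathfrak{a}}(M))$ is weakly Laskerian. Then $\operatorname{Ass}_R(H^i_{\mathfrak{a}}(M))$ is a finite set for any ideal $\mathfrak{a}$ of $R$ and all $i\geq 0$.
   Context: $H^i_{\mathfrak{a}}(M)=\varinjlim_n \operatorname{Ext}^i_R(R/\mathfrak{a}^n,M)$ is the $i$-th local cohomology module of $M$ with respect to $\mathfrak{a}$. An $R$-module $X$ is weakly Laskerian if $\operatorname{Ass}_R(X/N)$ is a finite set for every submodule $N$ of $X$. A Cohen-Macaulay module is, as usual, a finitely generated module. $\operatorname{grade}(\mathfrak{a},M)$ is the common length of all maximal $M$-regular sequences contained in $\mathfrak{a}$ when $\mathfrak{a}M\neq M$; when $\mathfrak{a}M=M$ it is $\infty$ and the hypothesis for that ideal is vacuous. *)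

(* Defs.v *)
From HB Require Import structures.
From mathcomp Require Import all_boot all_algebra ring_quotient.
From mathcomp Require Import finmap monalg.
From mathcomp Require Import boolp classical_sets functions cardinality.

Set Implicit Arguments.
Unset Strict Implicit.
Unset Printing Implicit Defensive.

Import GRing.Theory.
Local Open Scope ring_scope.
Local Open Scope quotient_scope.

(* Unlike MathComp's [idealr], which are proper, an ideal may be all of R. *)
Notation ideal R := (submodClosed R^o).

Section Submodules.
Variables (R : comNzRingType) (V : lmodType R).

Definition gen_pred (S : set V) : {pred V} :=
  fun x => `[< forall N : submodClosed V,
    (forall s, S s -> s \in N) -> x \in N >].

Fact gen_submod_closed S : submod_closed (gen_pred S).
Proof.
split; first by apply/asboolP => N _; exact: rpred0.
move=> a u v /asboolP Su /asboolP Sv; apply/asboolP => N SN.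
by rewrite rpredD ?rpredZ ?Su ?Sv.
Qed.
HB.instance Definition _ S :=
  GRing.isSubmodClosed.Build R V (gen_pred S) (gen_submod_closed S).

Definition gen_sub (S : set V) : submodClosed V := gen_pred S.

Definition zero_pred : {pred V} := pred1 0.
Fact zero_submod_closed : submod_closed zero_pred.
Proof.
split=> [|a u v]; rewrite !unfold_in //=.
by move=> /eqP -> /eqP ->; rewrite scaler0 addr0.
Qed.
HB.instance Definition _ :=
  GRing.isSubmodClosed.Build R V zero_pred zero_submod_closed.
Definition zero_sub : submodClosed V := zero_pred.

Definition full_pred : {pred V} := predT.
Fact full_submod_closed : submod_closed full_pred. Proof. by []. Qed.
HB.instance Definition _ :=
  GRing.isSubmodClosed.Build R V full_pred full_submod_closed.
Definition full_sub : submodClosed V := full_pred.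

Definition fin_gen := exists s : seq V, forall x, x \in gen_sub [set` s].

End Submodules.

Section SubmoduleType.
Variables (R : comNzRingType) (V : lmodType R) (N : submodClosed V).

Definition subm := {x : V | x \in N}.
HB.instance Definition _ := SubChoice.on subm.
HB.instance Definition _ := [SubChoice_isSubLmodule of subm by <:].

End SubmoduleType.

Section QuotientModule.
Variables (R : comNzRingType) (V : lmodType R) (N : submodClosed V).

(* [Quotient.quot] expects a [zmodClosed] predicate, which [submodClosed]
   does not provide because it is defined over semirings. *)
Definition zmod_pred : {pred V} := fun x => x \in N.
Fact zmod_pred_closed : zmod_closed zmod_pred.
Proof. exact: (GRing.submod_closedB (submodClosedP N)). Qed.
HB.instance Definition _ := GRing.isZmodClosed.Build V zmod_pred zmod_pred_closed.

Definition quom := Quotient.quot zmod_pred.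
HB.instance Definition _ := GRing.Zmodule.on quom.
HB.instance Definition _ := EqQuotient.on quom.

Lemma quom_eq (x y : V) : (\pi_quom x == \pi_quom y) = (x - y \in N).
Proof. by rewrite -(Quotient.idealrBE zmod_pred). Qed.

Fact pi_quom_is_additive : {morph \pi_quom : x y / x + y >-> x + y}.
Proof. by move=> x y; exact: (Quotient.pi_add zmod_pred x y). Qed.

Definition quom_scale (a : R) (x : quom) : quom := \pi_quom (a *: repr x).

Fact quom_scale_pi a x : quom_scale a (\pi_quom x) = \pi_quom (a *: x).
Proof.
apply/esym/eqP; rewrite quom_eq -scalerBr rpredZ // -quom_eq.
by rewrite reprK.
Qed.

Fact quom_scaleA a b v : quom_scale a (quom_scale b v) = quom_scale (a * b) v.
Proof.
by elim/quotW: v => v; rewrite (quom_scale_pi b) !quom_scale_pi scalerA.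
Qed.
Fact quom_scale1 : left_id 1 quom_scale.
Proof. by elim/quotW => v; rewrite quom_scale_pi scale1r. Qed.
Fact quom_scaleDr : right_distributive quom_scale +%R.
Proof.
move=> a; elim/quotW => u; elim/quotW => v; rewrite -pi_quom_is_additive.
by rewrite !quom_scale_pi -pi_quom_is_additive scalerDr.
Qed.
Fact quom_scaleDl v : {morph quom_scale^~ v : a b / a + b}.
Proof.
move=> a b; elim/quotW: v => v; rewrite !quom_scale_pi -pi_quom_is_additive.
by rewrite scalerDl.
Qed.
HB.instance Definition _ := GRing.Zmodule_isLmodule.Build R quom
  quom_scaleA quom_scale1 quom_scaleDr quom_scaleDl.

Definition quom_pi (x : V) : quom := \pi_quom x.
Fact quom_pi_is_linear : linear quom_pi.
Proof. by move=> a u v; rewrite /quom_pi pi_quom_is_additive -quom_scale_pi. Qed.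
HB.instance Definition _ :=
  GRing.isLinear.Build R V quom _ quom_pi quom_pi_is_linear.

End QuotientModule.

Section InducedMaps.
Variables (R : comNzRingType) (V W : lmodType R) (f : {linear V -> W}).

Definition ker_pred : {pred V} := fun x => f x == 0.
Fact ker_submod_closed : submod_closed ker_pred.
Proof.
split=> [|a u v]; rewrite !unfold_in ?linear0 //.
by move=> /eqP fu /eqP fv; rewrite linearP fu fv scaler0 addr0.
Qed.
HB.instance Definition _ :=
  GRing.isSubmodClosed.Build R V ker_pred ker_submod_closed.
Definition ker_sub : submodClosed V := ker_pred.

Definition image_pred : {pred W} := fun y => `[< exists x, y = f x >].
Fact image_submod_closed : submod_closed image_pred.
Proof.
split=> [|a u v]; first by apply/asboolP; exists 0; rewrite linear0.
move=> /asboolP[x ->] /asboolP[y ->]; apply/asboolP.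
by exists (a *: x + y); rewrite linearP.
Qed.
HB.instance Definition _ :=
  GRing.isSubmodClosed.Build R W image_pred image_submod_closed.
Definition image_sub : submodClosed W := image_pred.

Section Preimage.
Variable (Q : submodClosed W).
Definition preim_pred : {pred V} := fun x => f x \in Q.
Fact preim_submod_closed : submod_closed preim_pred.
Proof.
split; first by change (f 0 \in Q); rewrite linear0 rpred0.
move=> a u v fu fv; change (f (a *: u + v) \in Q).
by rewrite linearP rpredD ?rpredZ.
Qed.
HB.instance Definition _ :=
  GRing.isSubmodClosed.Build R V preim_pred preim_submod_closed.
Definition preim_sub : submodClosed V := preim_pred.
End Preimage.

Variables (P : submodClosed V) (Q : submodClosed W).
Let maps_to := forall x, x \in P -> f x \in Q.
Variable fPQ : maps_to.

Definition subm_map (x : subm P) : subm Q := Sub (f (val x)) (fPQ (valP x)).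
Fact subm_map_is_linear : linear subm_map.
Proof. by move=> a u v; apply: val_inj; rewrite /= linearP. Qed.
HB.instance Definition _ :=
  GRing.isLinear.Build R (subm P) (subm Q) _ subm_map subm_map_is_linear.

Definition quom_map of maps_to :=
  fun x : quom P => quom_pi Q (f (repr x)) : quom Q.
Fact quom_map_pi x : quom_map fPQ (quom_pi P x) = quom_pi Q (f x).
Proof.
apply/eqP; rewrite quom_eq -linearB fPQ // -quom_eq.
by rewrite reprK.
Qed.
Fact quom_map_is_linear : linear (quom_map fPQ).
Proof.
move=> a; elim/quotW => u; elim/quotW => v; rewrite -!/(quom_pi P _) -linearP.
by rewrite !quom_map_pi !linearP.
Qed.
HB.instance Definition _ :=
  GRing.isLinear.Build R (quom P) (quom Q) _
    (quom_map fPQ) quom_map_is_linear.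

End InducedMaps.

Section HomModule.
Variables (R : comNzRingType) (U V : lmodType R).

Definition hom_pred : {pred U -> V} := fun f => `[< linear f >].
Fact hom_submod_closed : submod_closed hom_pred.
Proof.
split=> [|a f g]; first by apply/asboolP => b u v; rewrite scaler0 addr0.
move=> /asboolP lf /asboolP lg; apply/asboolP => b u v.
rewrite !addrfctE !scalrfctE lf lg.
by rewrite !scalerDr !scalerA mulrC addrACA.
Qed.
HB.instance Definition _ :=
  GRing.isSubmodClosed.Build R (U -> V) hom_pred hom_submod_closed.
Definition homm : lmodType R := subm (hom_pred : submodClosed (U -> V)).

Definition hom_fun (f : homm) : U -> V := val f.
Fact hom_fun_is_linear (f : homm) : linear (hom_fun f).
Proof. exact/asboolP/(valP f). Qed.
HB.instance Definition _ (f : homm) :=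
  GRing.isLinear.Build R U V _ (hom_fun f) (hom_fun_is_linear f).

End HomModule.

Section Precomposition.
Variables (R : comNzRingType) (U V M : lmodType R) (f : {linear U -> V}).

Fact precomp_linear (g : homm V M) : (hom_fun g \o f) \in @hom_pred R U M.
Proof. by apply/asboolP => a u v /=; rewrite !linearP. Qed.
Definition precomp (g : homm V M) : homm U M :=
  Sub (hom_fun g \o f) (precomp_linear g).
Fact precomp_is_linear : linear precomp.
Proof. by move=> a u v; apply: val_inj. Qed.
HB.instance Definition _ :=
  GRing.isLinear.Build R (homm V M) (homm U M) _ precomp precomp_is_linear.

End Precomposition.
Arguments precomp {R U V} M f g.

Section FreeModule.
Variables (R : comNzRingType) (N : lmodType R).
Local Open Scope fset_scope.

Definition free_mod : lmodType R := {malg R[N]}.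

Section Extension.
Variables (V : lmodType R) (g : N -> V).

Definition free_ext (x : free_mod) : V := \sum_(k <- msupp x) x@_k *: g k.

Fact free_extEw (x : free_mod) (D : {fset N}) :
  msupp x `<=` D -> free_ext x = \sum_(k <- D) x@_k *: g k.
Proof.
move=> xD; rewrite /free_ext (big_fset_incl _ xD) // => k _ /mcoeff_outdom ->.
by rewrite scale0r.
Qed.

Fact free_ext_is_linear : linear free_ext.
Proof.
move=> a x y; pose D := msupp x `|` msupp y `|` msupp (a *: x + y).
have xD : msupp x `<=` D by rewrite /D -fsetUA fsubsetUl.
have yD : msupp y `<=` D by rewrite /D fsetUAC fsubsetUr.
have zD : msupp (a *: x + y) `<=` D by rewrite /D fsubsetUr.
rewrite (free_extEw xD) (free_extEw yD) (free_extEw zD) scaler_sumr -big_split.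
by apply: eq_bigr => k _; rewrite mcoeffD mcoeffZ scalerDl scalerA.
Qed.
HB.instance Definition _ :=
  GRing.isLinear.Build R free_mod V _ free_ext free_ext_is_linear.

Fact free_extU k : free_ext << k >> = g k.
Proof.
by rewrite (free_extEw (msuppU_le (k := k) (x := 1))) big_seq_fset1 mcoeffUU scale1r.
Qed.

End Extension.

Definition aug : {linear free_mod -> N} := free_ext idfun.

End FreeModule.

Fact free_hom_ext (R : comNzRingType) (N V : lmodType R)
    (f g : {linear free_mod N -> V}) :
  (forall k : N, f << k >> = g << k >>) -> f =1 g.
Proof.
move=> fg x; rewrite [x]monalgE !linear_sum /=; apply: eq_bigr => k _.
have -> : << x@_k *g k >> = x@_k *: << k >> :> free_mod N.
  by apply/malgP => l; rewrite mcoeffZ !mcoeffU mulr_natr.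
by rewrite !linearZ fg.
Qed.

Definition free_map (R : comNzRingType) (N N' : lmodType R) (f : N -> N') :
  {linear free_mod N -> free_mod N'} := free_ext (fun k => << f k >> : free_mod N').

Fact aug_free_map (R : comNzRingType) (N N' : lmodType R)
    (f : {linear N -> N'}) x : aug N' (free_map f x) = f (aug N x).
Proof.
have := @free_hom_ext R N N' (aug N' \o free_map f) (f \o aug N).
by apply => k /=; rewrite !free_extU.
Qed.

Section FreeResolution.
Variables (R : comNzRingType) (N : lmodType R).

(* The canonical free resolution of N: each module is covered by the free
   module on its elements, and the next syzygy is the kernel. *)
Fixpoint syz (k : nat) : lmodType R :=
  if k is j.+1 then subm (ker_sub (aug (syz j))) else N.

Definition free_res (k : nat) : lmodType R := free_mod (syz k).

Definition syz_incl (k : nat) : {linear syz k.+1 -> free_res k} :=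
  (val : subm (ker_sub (aug (syz k))) -> free_res k).

Definition free_res_d (k : nat) : {linear free_res k.+1 -> free_res k} :=
  syz_incl k \o aug (syz k.+1).

End FreeResolution.

Section FreeResolutionMap.
Variables (R : comNzRingType) (N N' : lmodType R) (f : {linear N -> N'}).

Fact free_map_ker (A B : lmodType R) (g : {linear A -> B}) x :
  x \in ker_sub (aug A) -> free_map g x \in ker_sub (aug B).
Proof.
by rewrite !unfold_in => /eqP x0; rewrite aug_free_map x0 linear0.
Qed.

Fixpoint syz_map (k : nat) : {linear syz N k -> syz N' k} :=
  if k is j.+1 return {linear syz N k -> syz N' k}
  then subm_map (@free_map_ker _ _ (syz_map j)) else f.

Definition res_map (k : nat) : {linear free_res N k -> free_res N' k} :=
  free_map (syz_map k).

Fact res_map_d k x : res_map k (free_res_d N k x) = free_res_d N' k (res_map k.+1 x).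
Proof.
rewrite /free_res_d /=.
have := aug_free_map (syz_map k.+1) x.
by rewrite /res_map => ->.
Qed.

End FreeResolutionMap.

Section Ext.
Variables (R : comNzRingType) (i : nat) (N M : lmodType R).

Definition cochain (k : nat) : lmodType R := homm (free_res N k) M.

Definition codiff (k : nat) : {linear cochain k -> cochain k.+1} :=
  precomp M (free_res_d N k).

Definition cocycles : submodClosed (cochain i) := ker_sub (codiff i).

Definition coboundaries : submodClosed (cochain i) :=
  match i with 0 => zero_sub (cochain 0) | j.+1 => image_sub (codiff j) end.

Definition Ext : lmodType R :=
  quom (preim_sub (val : subm cocycles -> cochain i) coboundaries).

End Ext.

Section ExtMap.
Variables (R : comNzRingType) (i : nat) (N N' M : lmodType R).
Variable f : {linear N -> N'}.

Definition cochain_map k : {linear cochain N' M k -> cochain N M k} :=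
  precomp M (res_map f k).

Fact codiff_cochain_map k g :
  codiff N M k (cochain_map k g) = cochain_map k.+1 (codiff N' M k g).
Proof.
apply: val_inj; apply/funext => x /=.
by congr (hom_fun g _); exact: res_map_d.
Qed.

Fact cochain_map_cocycles g :
  g \in cocycles i N' M -> cochain_map i g \in cocycles i N M.
Proof.
by rewrite !unfold_in => /eqP g0; rewrite codiff_cochain_map g0 linear0.
Qed.

Definition cocycle_map :
    {linear subm (cocycles i N' M) -> subm (cocycles i N M)} :=
  subm_map cochain_map_cocycles.

Fact cocycle_map_coboundaries z :
  z \in preim_sub (val : subm (cocycles i N' M) -> _) (coboundaries i N' M) ->
  cocycle_map z \in
    preim_sub (val : subm (cocycles i N M) -> _) (coboundaries i N M).
Proof.
rewrite !unfold_in /=; move: (val z) => g {z}; case: i g => [|j] g.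
  by move=> /eqP ->; apply/eqP; rewrite linear0.
move=> /asboolP[h ->]; apply/asboolP.
by exists (cochain_map j h); rewrite codiff_cochain_map.
Qed.

Definition Ext_map : {linear Ext i N' M -> Ext i N M} :=
  quom_map cocycle_map_coboundaries.

End ExtMap.

Section DirectProduct.
Variables (R : comNzRingType) (I : Type) (D : I -> lmodType R).

Definition dprod := forall i, D i.
HB.instance Definition _ := gen_eqMixin dprod.
HB.instance Definition _ := gen_choiceMixin dprod.

Let add (x y : dprod) : dprod := fun i => x i + y i.
Let scale (a : R) (x : dprod) : dprod := fun i => a *: x i.
Let ext (x y : dprod) : (forall i, x i = y i) -> x = y.
Proof. exact: functional_extensionality_dep. Qed.
Let addA : associative add.
Proof. by move=> x y z; apply: ext => i; exact: addrA. Qed.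
Let addC : commutative add.
Proof. by move=> x y; apply: ext => i; exact: addrC. Qed.
Let add0 : left_id (fun i => 0) add.
Proof. by move=> x; apply: ext => i; exact: add0r. Qed.
Let addN : left_inverse (fun i => 0) (fun x i => - x i) add.
Proof. by move=> x; apply: ext => i; exact: addNr. Qed.
HB.instance Definition _ := GRing.isZmodule.Build dprod addA addC add0 addN.

Let scaleA a b x : scale a (scale b x) = scale (a * b) x.
Proof. by apply: ext => i; exact: scalerA. Qed.
Let scale1 : left_id 1 scale.
Proof. by move=> x; apply: ext => i; exact: scale1r. Qed.
Let scaleDr : right_distributive scale +%R.
Proof. by move=> a x y; apply: ext => i; exact: scalerDr. Qed.
Let scaleDl x : {morph scale^~ x : a b / a + b}.
Proof. by move=> a b; apply: ext => i; exact: scalerDl. Qed.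
HB.instance Definition _ :=
  GRing.Zmodule_isLmodule.Build R dprod scaleA scale1 scaleDr scaleDl.

End DirectProduct.

Section DirectLimit.
Variables (R : comNzRingType) (D : nat -> lmodType R).
Variable f : forall n, {linear D n -> D n.+1}.

Definition fin_supp_pred : {pred dprod D} :=
  fun x => `[< finite_set [set n | x n != 0] >].
Fact fin_supp_submod_closed : submod_closed fin_supp_pred.
Proof.
split=> [|a u v].
  apply/asboolP; rewrite (_ : mkset _ = set0) //.
  by apply/seteqP; split => n //=; rewrite eqxx.
move=> /asboolP fu /asboolP fv; apply/asboolP.
apply: sub_finite_set (_ : finite_set ([set n | u n != 0] `|` [set n | v n != 0])).
  move=> n /= uv; apply/orP; rewrite -negb_and; apply: contra uv => /andP[/eqP u0 /eqP v0].
  by rewrite -[X in X == _]/(a *: u n + v n) u0 v0 scaler0 addr0.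
by rewrite finite_setU.
Qed.
HB.instance Definition _ :=
  GRing.isSubmodClosed.Build R (dprod D) fin_supp_pred fin_supp_submod_closed.

Definition dsum : lmodType R := subm (fin_supp_pred : submodClosed (dprod D)).

Fact dsum_in_fin_supp n (x : D n) :
  (dfwith (fun=> 0) x : dprod D) \in fin_supp_pred.
Proof.
apply/asboolP; apply: sub_finite_set (finite_set1 n) => k /=.
by case: dfwithP => //= l; rewrite eqxx.
Qed.
Definition dsum_in n (x : D n) : dsum :=
  Sub (dfwith (fun=> 0) x : dprod D) (dsum_in_fin_supp x).

Definition dirlim : lmodType R :=
  quom (gen_sub [set y : dsum | exists n (x : D n),
                y = dsum_in x - dsum_in (f n x)]).

End DirectLimit.

Section Ideals.
Variable R : comNzRingType.
Implicit Types (a m : ideal R) (M X : lmodType R).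

(* a N, for an ideal a and a submodule N; the product of ideals is the case
   M = R^o. *)
Definition ideal_act M a (N : submodClosed M) : submodClosed M :=
  gen_sub [set z | exists r x, [/\ r \in a, x \in N & z = r *: x]].

Fact ideal_act_sub M a (N : submodClosed M) x : x \in ideal_act a N -> x \in N.
Proof. by move/asboolP; apply => _ [r [y [_ yN ->]]]; exact: rpredZ. Qed.

Definition ideal_exp a (n : nat) : ideal R :=
  iter n (@ideal_act R^o a) (full_sub R^o).

Definition quot_exp a (n : nat) : lmodType R := quom (ideal_exp a n).

Definition quot_exp_proj a (n : nat) :
    {linear quot_exp a n.+1 -> quot_exp a n} :=
  quom_map (@ideal_act_sub R^o a (ideal_exp a n) :
    forall x, x \in ideal_exp a n.+1 -> idfun x \in ideal_exp a n).

Definition local_cohomology a (i : nat) M : lmodType R :=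
  dirlim (fun n => Ext_map i M (quot_exp_proj a n)).

Definition prime_ideal (p : {pred R}) := idealr_closed p /\ prime_idealr_closed p.

Definition Ass X : set (pred R) :=
  [set p | prime_ideal p /\ exists x : X, p =i [pred r | r *: x == 0]].

Definition weakly_laskerian X :=
  forall N : submodClosed X, finite_set (Ass (quom N)).

Definition noetherian_ring :=
  forall a, exists s : seq R^o, a =i gen_sub [set` s].

Definition maximal_ideal m :=
  1 \notin m /\ forall a, {subset m <= a} -> 1 \notin a -> a =i m.

Definition local_ring m :=
  maximal_ideal m /\ forall m', maximal_ideal m' -> m' =i m.

Definition seq_act M (s : seq R) : submodClosed M :=
  gen_sub [set z | exists2 r, r \in s & exists x, z = r *: x].

Definition nonzerodivisor X (r : R) := forall x : X, r *: x = 0 -> x = 0.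

Definition regular_seq M (s : seq R) :=
  (forall i, (i < size s)%N ->
     nonzerodivisor (quom (seq_act M (take i s))) (nth 0 s i)) /\
  exists x : M, x \notin seq_act M s.

Definition maximal_regular_seq a M (s : seq R) :=
  [/\ {subset s <= a}, regular_seq M s &
      forall r, r \in a -> ~ regular_seq M (rcons s r)].

(* grade(a, M) = t; never holds when a M = M, where the grade is infinite. *)
Definition is_grade a M (t : nat) :=
  [/\ exists x, x \notin ideal_act a (full_sub M),
      exists s, maximal_regular_seq a M s &
      forall s, maximal_regular_seq a M s -> size s = t].

Definition annihilator M : {pred R} := fun r => `[< forall x : M, r *: x = 0 >].

Definition prime_chain M (d : nat) := exists p : nat -> pred R,
  (forall i, (i <= d)%N ->
     prime_ideal (p i) /\ {subset annihilator M <= p i}) /\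
  (forall i, (i < d)%N ->
     {subset p i <= p i.+1} /\ ~ {subset p i.+1 <= p i}).

(* dim M = dim (R / Ann M), for M finitely generated. *)
Definition is_dim M (d : nat) :=
  prime_chain M d /\ forall e, prime_chain M e -> (e <= d)%N.

(* The zero module is Cohen-Macaulay; depth M is grade(m, M). *)
Definition cohen_macaulay m M :=
  fin_gen M /\
  ((exists x : M, x != 0) -> exists d, is_grade m M d /\ is_dim M d).

End Ideals.

(* Main.v *)
(* For i < t = grade(a, M) the module H^i_a(M) vanishes, for i = t its associated
   primes are among those of M/sM with s a maximal M-regular sequence in a, and for
   i = t + 1 they are those of the weakly Laskerian module Hom(R/a, H^(t+1)_a(M)),
   all elements of H^i_a(M) being a-torsion.  For i > t + 1 the ideal is enlarged.
   As M is Cohen-Macaulay, Ass(M/sM) is an antichain, so some y lies in exactly those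
   of its members that do not contain a.  On the open set where y is invertible, a is
   then generated by s up to radical on the support of M, whence every element of
   H^j_a(M) is killed by a power of y for j > t, and the exact sequence
     H^(i-1)_a(M)_y -> H^i_(a+Ry)(M) -> H^i_a(M) -> H^i_a(M)_y
   identifies H^i_a(M) with H^i_(a+Ry)(M).  The grade of a + Ry exceeds t, so the
   induction is on i - t.

   The same sequence, applied to one generator at a time, gives the vanishing of
   H^j_(s)(M) for j > |s| and the invariance of H^j_a(M), j > 0, under adding elements
   of Ann M to a.  It is obtained from the long exact Ext sequence of
     0 -> R/(a^n : y^m) -> R/a^n -> R/(a^n + y^m R) -> 0,
   where (a^n : y^m) is stationary in m because R is Noetherian. *)

Require Import Defs.
From HB Require Import structures.
From mathcomp Require Import all_boot all_algebra monalg.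
From mathcomp Require Import boolp classical_sets functions cardinality.

Set Implicit Arguments.
Unset Strict Implicit.
Unset Printing Implicit Defensive.

Import GRing.Theory.
Local Open Scope ring_scope.
Local Open Scope classical_set_scope.

(** No localized module and no exact sequence of local cohomology modules is ever formed. Vanishing
    after inverting [y] is expressed by [power_torsion], and an isomorphism of cohomology modules by
    [ann_sub]: associated primes and vanishing depend only on annihilators of elements, so it is
    enough to move single classes. The obstacle is that the comparison of a with (s) is local in two
    ways: it holds only where [y] is invertible and only on the support of M. Powers of [y] absorb
    the first restriction. Adding the same generators of Ann M to both ideals absorbs the second and
    leaves a statement about primes of R. The Cohen-Macaulay property enters through lengths of
    chains of primes. A regular sequence s yields a chain ending at any prime of the support that
    contains it, a continuation of s inside m yields a chain starting at any associated prime of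
    M/sM, and together they cannot be longer than dim M = depth M. This gives the antichain property
    and also the equal lengths of maximal regular sequences in a given ideal. *)

Section LinearMaps.
Variable R : comNzRingType.
Implicit Types A B P Q V : lmodType R.

Definition mklin A B (f : A -> B) (lf : linear f) : {linear A -> B} :=
  HB.pack f (GRing.isLinear.Build R A B _ f lf).

Definition insubm A (N : submodClosed A) x (Nx : x \in N) : subm N := Sub x Nx.

Definition surj_lin A B (f : A -> B) := forall b, exists a, f a = b.

Lemma lin_factor_surj P A B (p : {linear P -> A}) (f : {linear P -> B}) :
  surj_lin p -> (forall x, p x = 0 -> f x = 0) ->
  exists g : {linear A -> B}, forall x, g (p x) = f x.
Proof.
move=> /choice[s ps] f0.
have fs x : f (s (p x)) = f x.
  by apply/eqP; rewrite -subr_eq0 -linearB f0 // linearB ps subrr.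
have lg : linear (f \o s).
  move=> a u v /=; rewrite -linearP; apply/eqP; rewrite -subr_eq0 -linearB f0 //.
  by rewrite linearB linearP !ps subrr.
by exists (mklin lg).
Qed.

Lemma lin_factor_inj P A B (i : {linear A -> B}) (f : {linear P -> B}) :
  injective i -> (forall x, exists y, f x = i y) ->
  exists g : {linear P -> A}, forall x, i (g x) = f x.
Proof.
move=> ii /choice[s fs].
have ls : linear s by move=> a u v; apply: ii; rewrite linearP -!fs linearP.
by exists (mklin ls) => x /=.
Qed.

Definition projective P := forall A B (q : {linear A -> B}) (f : {linear P -> B}),
  surj_lin q -> exists g : {linear P -> A}, forall x, q (g x) = f x.

Lemma projective_retract P Q (i : {linear P -> Q}) (r : {linear Q -> P}) :
  cancel i r -> projective Q -> projective P.
Proof.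
move=> ir pQ A B q f /(pQ A B q (f \o r))[g qg].
by exists (g \o i) => x /=; rewrite qg /= ir.
Qed.

Lemma projective_free A : projective (free_mod A).
Proof.
move=> B C q f /choice[s qs].
exists (free_ext (fun k => s (f (<< k >> : free_mod A)))) => x.
apply: (@free_hom_ext R A C (q \o free_ext _) f) => k /=.
by rewrite free_extU qs.
Qed.

Lemma aug_surj A : surj_lin (aug A).
Proof. by move=> a; exists (<< a >> : free_mod A); rewrite /aug /= free_extU. Qed.

Lemma free_mapU A B (f : A -> B) a :
  free_map f (<< a >> : free_mod A) = (<< f a >> : free_mod B).
Proof. by rewrite /free_map /= free_extU. Qed.

Lemma aug_U A a : aug A (<< a >> : free_mod A) = a.
Proof. by rewrite /aug /= free_extU. Qed.

Section PropSubmodule.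
Variables (V : lmodType R) (D : V -> Prop).
Hypothesis DP : D 0 /\ forall a u v, D u -> D v -> D (a *: u + v).

Definition psub_pred (_ : D 0 /\ forall a u v, D u -> D v -> D (a *: u + v)) : {pred V} :=
  fun x => `[< D x >].
Fact psub_closed : submod_closed (psub_pred DP).
Proof.
case: DP => D0 Dl; split; first exact/asboolP.
by move=> a u v /asboolP Du /asboolP Dv; exact/asboolP/Dl.
Qed.
HB.instance Definition _ :=
  GRing.isSubmodClosed.Build R V (psub_pred DP) psub_closed.
Definition psub : submodClosed V := psub_pred DP.

Lemma psubP x : reflect (D x) (x \in psub).
Proof. exact: asboolP. Qed.
End PropSubmodule.

End LinearMaps.

(** * Resolutions and the comparison theorem *)

Section Resolutions.
Variable R : comNzRingType.

(** A resolution is stored as short exact sequences S_(j+1) -> P_j -> S_j rather than as a complex,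
    which builds in dimension shifting. The abstraction is there for two instances: the canonical
    free resolution and the kernel of a surjection between two of them. *)
Record resol := Resol {
  rS : nat -> lmodType R;
  rP : nat -> lmodType R;
  rp : forall j, {linear rP j -> rS j};
  ri : forall j, {linear rS j.+1 -> rP j};
  rp_surj : forall j, surj_lin (rp j);
  ri_inj : forall j, injective (ri j);
  rp_ri : forall j x, rp j (ri j x) = 0;
  r_exact : forall j x, rp j x = 0 -> exists y, x = ri j y;
  r_proj : forall j, projective (rP j) }.

Implicit Types X Y Z : resol.

(* Elements of Ext^j are represented by linear maps [g] from the j-th syzygy;
   [triv g] says that the class of [g] is zero. *)
Definition triv X j (M : lmodType R) : (rS X j -> M) -> Prop :=
  match j return (rS X j -> M) -> Prop with
  | 0 => fun g => forall x, g x = 0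
  | j.+1 => fun g => exists h : {linear rP X j -> M}, forall x, g x = h (ri X j x)
  end.

Definition is_lift X Y (u : forall j, rS X j -> rS Y j) :=
  forall j, exists phi : {linear rP X j -> rP Y j},
    (forall x, rp Y j (phi x) = u j (rp X j x)) /\
    (forall x, ri Y j (u j.+1 x) = phi (ri X j x)).

Lemma triv_ext X j (M : lmodType R) (g g' : rS X j -> M) : g =1 g' -> triv g -> triv g'.
Proof.
case: j g g' => [|j] g g' gg /=; first by move=> g0 x; rewrite -gg.
by case=> h gh; exists h => x; rewrite -gg.
Qed.

Lemma triv_lin X j (M : lmodType R) a (g g' : rS X j -> M) :
  triv g -> triv g' -> triv (fun x => a *: g x + g' x).
Proof.
case: j g g' => [|j] g g' /=.
  by move=> g0 g0' x; rewrite g0 g0' scaler0 addr0.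
move=> [h gh] [h' gh']; exists (a \*: h \+ h') => x /=.
by rewrite gh gh'.
Qed.

Lemma triv0 X j (M : lmodType R) : triv (fun _ : rS X j => 0 : M).
Proof. by case: j => [|j] //=; exists \0. Qed.

Lemma trivZ X j (M : lmodType R) a (g : rS X j -> M) :
  triv g -> triv (fun x => a *: g x).
Proof.
move=> t; apply: triv_ext (triv_lin a t (triv0 X j M)) => x /=.
by rewrite addr0.
Qed.

Lemma triv_post X j (M N : lmodType R) (f : {linear M -> N}) (g : rS X j -> M) :
  triv g -> triv (f \o g).
Proof.
case: j g => [|j] g /=; first by move=> g0 x; rewrite g0 linear0.
by case=> h gh; exists (f \o h) => x /=; rewrite gh.
Qed.

Lemma triv_lift X Y u j (M : lmodType R) (g : rS Y j -> M) :
  is_lift u -> triv g -> triv (g \o (u j : rS X j -> rS Y j)).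
Proof.
case: j g => [|j] g lu /=; first by move=> g0 x; exact: g0.
case=> h gh; have [phi [_ pi]] := lu j.
by exists (h \o phi) => x /=; rewrite gh pi.
Qed.

Lemma lift_comp X Y Z u v : is_lift u -> is_lift v ->
  is_lift (fun j => (v j : rS Y j -> rS Z j) \o (u j : rS X j -> rS Y j)).
Proof.
move=> lu lv j; have [f [f1 f2]] := lu j; have [g [g1 g2]] := lv j.
by exists (g \o f); split=> x /=; rewrite ?g1 ?f1 ?g2 ?f2.
Qed.

Lemma lift_id X : is_lift (fun j => (fun x : rS X j => x)).
Proof. by move=> j; exists idfun. Qed.

Lemma lift_scale X r : is_lift (fun j => (fun x : rS X j => r *: x)).
Proof. by move=> j; exists (r \*: idfun); split=> x /=; rewrite linearZ. Qed.

Lemma lift_uniq X Y u v : @is_lift X Y u -> is_lift v -> u 0 =1 v 0 ->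
  forall j, triv (fun x => u j x - v j x).
Proof.
move=> lu lv uv0; elim=> [|j IH] /=; first by move=> x; rewrite uv0 subrr.
have [f [f1 f2]] := lu j; have [g [g1 g2]] := lv j.
(* [e] is the term of the chain homotopy that comes from the previous degree. It accounts for the
   difference of the two chain maps on the quotient and vanishes on the next syzygy, so
   [f \- g \- e] lands in that syzygy and is the next term of the homotopy. *)
suff [e e0] : exists e : {linear rP X j -> rP Y j},
    (forall x, rp Y j (e x) = u j (rp X j x) - v j (rp X j x)) /\
    (forall x, e (ri X j x) = 0).
  case: e0 => e1 e2; pose k : {linear rP X j -> rP Y j} := f \- g \- e.
  have [|h kh] := @lin_factor_inj R _ _ _ (ri Y j) k (@ri_inj Y j).
    by move=> x; apply: r_exact; rewrite /k /= !linearB f1 g1 e1 subrr.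
  exists h => x; apply: (@ri_inj Y j).
  by rewrite kh linearB f2 g2 /k /= e2 subr0.
clear f f1 f2 g g1 g2; case: j IH => [|j] /=.
  by move=> uv; exists \0 => /=; split=> // x; rewrite linear0 uv.
case=> h uvh; have [k kh] := @r_proj X j _ _ (rp Y j.+1) h (@rp_surj Y j.+1).
exists (k \o (ri X j \o rp X j.+1)); split=> x /=; first by rewrite kh uvh.
by rewrite rp_ri !linear0.
Qed.

Lemma lift_exists X Y (f : {linear rS X 0 -> rS Y 0}) :
  exists u : forall j, {linear rS X j -> rS Y j}, is_lift u /\ u 0 = f.
Proof.
have next j (u : {linear rS X j -> rS Y j}) :
    {w : {linear rS X j.+1 -> rS Y j.+1} | exists phi : {linear rP X j -> rP Y j},
    (forall x, rp Y j (phi x) = u (rp X j x)) /\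
    (forall x, ri Y j (w x) = phi (ri X j x))}.
  apply: cid.
  have [phi e1] := @r_proj X j _ _ (rp Y j) (u \o rp X j) (@rp_surj Y j).
  have [|w e2] := @lin_factor_inj R _ _ _ (ri Y j) (phi \o ri X j) (@ri_inj Y j).
    by move=> x; apply: r_exact; rewrite /= e1 /= rp_ri linear0.
  by exists w, phi.
pose u := fix u j : {linear rS X j -> rS Y j} :=
  match j with 0 => f | j.+1 => sval (next j (u j)) end.
by exists u; split=> // j; exact: (svalP (next j (u j))).
Qed.

(** Pulling back an Ext class depends only on the map in degree 0, by [lift_uniq]. This is how
    composites of syzygy maps are exchanged for one another. *)
Lemma triv_lift_uniq X Y u v j (M : lmodType R) (g : {linear rS Y j -> M}) :
  @is_lift X Y u -> is_lift v -> u 0 =1 v 0 ->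
  triv (g \o v j) -> triv (g \o u j).
Proof.
move=> lu lv uv gv; have /(triv_post g) d := lift_uniq lu lv uv j.
apply: triv_ext (triv_lin 1 d gv) => x /=.
by rewrite scale1r linearB subrK.
Qed.

End Resolutions.

(** * The canonical free resolution and its maps on syzygies *)

Section Canonical.
Variable R : comNzRingType.
Implicit Types N B C K M : lmodType R.

Fact can_exact N j x : aug (syz N j) x = 0 -> exists y, x = syz_incl N j y.
Proof.
move=> x0; have xk : x \in ker_sub (aug (syz N j)) by rewrite unfold_in x0.
by exists (Sub x xk).
Qed.

Definition free_resol N : resol R := @Resol R (syz N) (free_res N)
  (fun j => aug (syz N j)) (fun j => syz_incl N j)
  (fun j => @aug_surj R (syz N j)) (fun j => val_inj)
  (fun j x => eqP (valP x)) (@can_exact N)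
  (fun j => @projective_free R (syz N j)).

Lemma syz_map_lift N N' (f : {linear N -> N'}) :
  @is_lift R (free_resol N) (free_resol N') (syz_map f).
Proof.
move=> j; exists (free_map (syz_map f j)); split=> x //.
by rewrite [LHS]aug_free_map.
Qed.

End Canonical.

Section SyzygyMaps.
Variable R : comNzRingType.
Implicit Types A N B C K M : lmodType R.

Lemma triv_syz_comp N1 N2 N3 i M (f : {linear N1 -> N2}) (f' : {linear N2 -> N3})
    (h : {linear N1 -> N3}) (g : {linear syz N3 i -> M}) :
  (forall x, h x = f' (f x)) ->
  @triv R (free_resol N1) i M (g \o syz_map h i) <->
  @triv R (free_resol N1) i M (g \o syz_map f' i \o syz_map f i).
Proof.
move=> hE; have lc := lift_comp (syz_map_lift f) (syz_map_lift f').
split; first exact: (triv_lift_uniq lc (syz_map_lift h)).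
exact: (@triv_lift_uniq R (free_resol N1) (free_resol N3) _ _ i M g (syz_map_lift h) lc).
Qed.

(** Over a projective module every augmentation splits, so all syzygies are projective and each
    inclusion has a retraction [r], along which [g] extends. *)
Lemma syz_proj_triv N i M (g : {linear syz N i.+1 -> M}) :
  projective N -> @triv R (free_resol N) i.+1 M g.
Proof.
move=> pN; suff [_ [r rK]] : projective (syz N i) /\
    exists r : {linear free_res N i -> syz N i.+1}, forall x, r (syz_incl N i x) = x.
  by exists (g \o r) => x /=; rewrite rK.
have retr A : projective A ->
    exists r : {linear free_mod A -> subm (ker_sub (aug A))}, forall x, r (val x) = x.
  move=> /(_ _ _ (aug A) idfun (@aug_surj R A))[s sK].
  have [|r rK] := @lin_factor_inj R (free_mod A) (subm (ker_sub (aug A)))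
      (free_mod A) val (idfun \- (s \o aug A)) val_inj.
    move=> x; have xk : x - s (aug A x) \in ker_sub (aug A).
      by rewrite unfold_in linearB /= sK subrr.
    by exists (insubm xk).
  exists r => x; apply: val_inj; rewrite rK /=.
  by have /eqP -> := valP x; rewrite linear0 subr0.
have pS : projective (syz N i).
  elim: i {M g} => [|i IH] //=; have [r rK] := retr _ IH.
  exact: (@projective_retract R _ _ (syz_incl N i) r rK (@projective_free R _)).
by split=> //; exact: retr.
Qed.

(** [free_map] accepts arbitrary functions, so a section of sets already splits it. Every surjection
    thereby induces split surjections on the free modules. *)
Lemma free_map_section A B (f : A -> B) (s : B -> A) : cancel s f ->
  cancel (free_map s) (free_map f).
Proof.
move=> sf x; have := @free_hom_ext R B (free_mod B) (free_map f \o free_map s) idfun.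
by apply => k /=; rewrite !free_mapU sf.
Qed.

Lemma free_map_surj A B (f : A -> B) : surj_lin f -> surj_lin (free_map f).
Proof. by move=> /choice[s /free_map_section fs] x; exists (free_map s x). Qed.

Lemma syz_map_surj B C (b : {linear B -> C}) j :
  surj_lin b -> surj_lin (syz_map b j).
Proof.
move=> sb; elim: j => [|j IH] //= c.
have [x xc] := free_map_surj IH (val c).
(* [<< aug _ x >> - << 0 >>] has the same augmentation as [x], and its image vanishes because
   [aug _ x] is sent to the augmentation of [val c], which is 0. The term [<< 0 >>] is needed
   because it is a basis vector and not 0. *)
pose x' : free_res B j := x - (<< aug _ x >> - << 0 >>).
have x'k : x' \in ker_sub (aug (syz B j)).
  by rewrite unfold_in /x' linearB linearB !aug_U subr0 subrr.
exists (insubm x'k); apply: val_inj => /=.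
rewrite /x' !linearB /= xc !free_mapU linear0.
rewrite -aug_free_map xc.
have /eqP -> := valP c; rewrite subrr.
by rewrite addr0.
Qed.

(** [free_map] permutes basis vectors, so the canonical resolution is functorial strictly and not
    just up to homotopy. *)
Lemma syz_map_square N1 N2 N3 N4 (f : {linear N1 -> N2}) (g : {linear N2 -> N4})
    (f' : {linear N1 -> N3}) (g' : {linear N3 -> N4}) j :
  (forall x, g (f x) = g' (f' x)) ->
  forall x, syz_map g j (syz_map f j x) = syz_map g' j (syz_map f' j x).
Proof.
move=> sq; elim: j => [|j IH] //= x; apply: val_inj => /=.
apply: (@free_hom_ext R _ _ (free_map (syz_map g j) \o free_map (syz_map f j))
  (free_map (syz_map g' j) \o free_map (syz_map f' j))) => k /=.
by rewrite !free_mapU IH.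
Qed.

End SyzygyMaps.

(** * Long exact sequence of Ext in the first variable *)

Section KernelResolution.
Variables (R : comNzRingType) (B C : lmodType R) (b : {linear B -> C}).
Hypothesis sb : surj_lin b.

Let L j : lmodType R := subm (ker_sub (syz_map b j)).
Let P j : lmodType R := subm (ker_sub (res_map b j)).

Fact ker_resol_p_ker j x : x \in ker_sub (res_map b j) ->
  aug (syz B j) x \in ker_sub (syz_map b j).
Proof.
rewrite !unfold_in => /eqP x0.
by rewrite -aug_free_map -/(res_map b j) x0 linear0.
Qed.
Let p j : {linear P j -> L j} := subm_map (@ker_resol_p_ker j).

Fact ker_resol_i_ker j x : x \in ker_sub (syz_map b j.+1) ->
  syz_incl B j x \in ker_sub (res_map b j).
Proof. by rewrite !unfold_in => /eqP /(congr1 val) /= ->. Qed.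
Let i j : {linear L j.+1 -> P j} := subm_map (@ker_resol_i_ker j).

Fact ker_resol_p_surj j : surj_lin (p j).
Proof.
(* [res_map b j] sends [<< val k >>] to the basis vector [<< 0 >>]; subtracting [<< 0 >>] puts the
   lift into the kernel without changing its augmentation. *)
move=> k; pose x : free_res B j := << val k >> - << 0 >>.
have xk : x \in ker_sub (res_map b j).
  rewrite unfold_in /x linearB /res_map /= !free_mapU linear0.
  by have /eqP -> := valP k; rewrite subrr.
exists (insubm xk); apply: val_inj.
by rewrite /= /x linearB /= !aug_U subr0.
Qed.

Fact ker_resol_i_inj j : injective (i j).
Proof. by move=> x y xy; do 2 apply: val_inj; exact: (congr1 val xy). Qed.

Fact ker_resol_pi j x : p j (i j x) = 0.
Proof. by apply: val_inj => /=; exact: (eqP (valP (val x))). Qed.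

Fact ker_resol_exact j x : p j x = 0 -> exists y, x = i j y.
Proof.
move=> x0; have {}x0 : aug (syz B j) (val x) = 0 := congr1 val x0.
have xk : val x \in ker_sub (aug (syz B j)) by rewrite unfold_in x0.
have yk : (insubm xk : syz B j.+1) \in ker_sub (syz_map b j.+1).
  by rewrite unfold_in; apply/eqP/val_inj => /=; exact: (eqP (valP x)).
by exists (insubm yk); apply: val_inj.
Qed.

Lemma ker_resol_retract j : exists r : {linear free_res B j -> P j},
  cancel (val : P j -> _) r.
Proof.
have /choice[s /free_map_section sK] := @syz_map_surj R B C b j sb.
have [|r rK] := @lin_factor_inj R (free_res B j) (P j) (free_res B j)
    val (idfun \- (free_map s \o res_map b j)) val_inj.
  move=> x; have xk : x - free_map s (res_map b j x) \in ker_sub (res_map b j).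
    by rewrite unfold_in linearB /= sK subrr.
  by exists (insubm xk).
exists r => x; apply: val_inj; rewrite rK /=.
by have /eqP -> := valP x; rewrite linear0 subr0.
Qed.

Fact ker_resol_proj j : projective (P j).
Proof.
have [r rK] := ker_resol_retract j.
exact: (@projective_retract R _ _ (val : P j -> _) r rK (@projective_free R _)).
Qed.

(** A substitute for the horseshoe lemma: instead of resolving B from resolutions of the outer
    terms, the kernel of b is resolved by the termwise kernels of the surjection of canonical
    resolutions, which are direct summands of the free modules over B. *)
Definition ker_resol : resol R :=
  Resol ker_resol_p_surj ker_resol_i_inj ker_resol_pi ker_resol_exact ker_resol_proj.

Definition ker_resol_val j : {linear rS ker_resol j -> syz B j} := val : L j -> syz B j.

Lemma ker_resol_val_lift : @is_lift R ker_resol (free_resol B) ker_resol_val.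
Proof. by move=> j; exists (val : P j -> free_res B j). Qed.

(* [P j] is a direct summand of [free_res B j]. *)
Lemma ker_resol_triv_extend j (M : lmodType R) (g : rS ker_resol j -> M) : triv g ->
  exists f : {linear syz B j -> M},
    @triv R (free_resol B) j M f /\ forall x, f (ker_resol_val j x) = g x.
Proof.
case: j g => [|j] g /=.
  by move=> g0; exists \0; split=> // x; rewrite g0.
case=> h gh; have [r rK] := ker_resol_retract j.
exists (h \o r \o syz_incl B j); split; first by exists (h \o r).
by move=> x; rewrite gh /= -[in RHS](rK (i j x)).
Qed.

End KernelResolution.

Section ShortExact.
Variable R : comNzRingType.
Implicit Types A N B C K M : lmodType R.

Definition short_exact K B C (a : {linear K -> B}) (b : {linear B -> C}) :=
  [/\ injective a, surj_lin b, forall x, b (a x) = 0 &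
      forall x, b x = 0 -> exists y, x = a y].

Lemma short_exact_ker_resol K B C (a : {linear K -> B}) (b : {linear B -> C})
    (sb : surj_lin b) : short_exact a b ->
  exists f : {linear rS (ker_resol sb) 0 -> K}, forall x, a (f x) = ker_resol_val sb 0 x.
Proof.
case=> ia _ _ ex; have [|f fE] := @lin_factor_inj R _ _ _ a (ker_resol_val sb 0) ia.
  by move=> x; apply: ex; exact: (eqP (valP x)).
by exists f.
Qed.

Lemma short_exact_ker_resolV K B C (a : {linear K -> B}) (b : {linear B -> C})
    (sb : surj_lin b) : short_exact a b ->
  exists f : {linear K -> rS (ker_resol sb) 0}, forall x, ker_resol_val sb 0 (f x) = a x.
Proof.
case=> ia _ ba _; have [|f fE] := @lin_factor_inj R _ _ _ (ker_resol_val sb 0) a val_inj.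
  move=> x; have ax : a x \in ker_sub (syz_map b 0) by rewrite unfold_in /= ba.
  by exists (insubm ax).
by exists f.
Qed.

(** On the kernel of [syz_map b i] the map [xi] agrees with a trivial [f] defined on all of
    [syz B i]. Hence [xi \- f] descends to [syz C i]. This is exactness at Ext^i(B, M). *)
Lemma Ext_exact_middle K B C (a : {linear K -> B}) (b : {linear B -> C}) i M
    (xi : {linear syz B i -> M}) :
  short_exact a b -> @triv R (free_resol K) i M (xi \o syz_map a i) ->
  exists eta : {linear syz C i -> M},
    @triv R (free_resol B) i M (fun x => xi x - eta (syz_map b i x)).
Proof.
move=> sE; have [ia sb ba ex] := sE => xia.
have [f0 f0E] := short_exact_ker_resol sb sE.
have [t [lt t0]] := @lift_exists R (ker_resol sb) (free_resol K) f0.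
have xiv : triv (xi \o ker_resol_val sb i).
  apply: (triv_lift_uniq (ker_resol_val_lift sb) (lift_comp lt (syz_map_lift a))).
    by move=> x; rewrite /= t0 f0E.
  exact: (triv_lift lt xia).
have [f [tf fE]] := ker_resol_triv_extend xiv.
have [|eta etaE] := @lin_factor_surj R _ _ _ (syz_map b i) (xi \- f) (@syz_map_surj R B C b i sb).
  move=> x x0; have xk : x \in ker_sub (syz_map b i) by rewrite unfold_in x0.
  by have := fE (insubm xk); rewrite /= => ->; rewrite subrr.
exists eta; apply: triv_ext tf => x.
by rewrite etaE /= opprB addrCA subrr addr0.
Qed.

(** Exactness at Ext^(i+1)(C, M) together with naturality of the connecting map, which itself is not
    defined: [zeta] is a preimage of [eta], and killing [zeta] along a morphism of short exact
    sequences kills [eta]. *)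
Lemma Ext_exact_right K B C (a : {linear K -> B}) (b : {linear B -> C}) i M
    (eta : {linear syz C i.+1 -> M}) :
  short_exact a b -> @triv R (free_resol B) i.+1 M (eta \o syz_map b i.+1) ->
  exists zeta : {linear syz K i -> M},
  forall K' B' C' (a' : {linear K' -> B'}) (b' : {linear B' -> C'})
    (k : {linear K' -> K}) (f : {linear B' -> B}) (c : {linear C' -> C}),
    short_exact a' b' -> (forall x, a (k x) = f (a' x)) ->
    (forall x, b (f x) = c (b' x)) ->
    @triv R (free_resol K') i M (zeta \o syz_map k i) ->
    @triv R (free_resol C') i.+1 M (eta \o syz_map c i.+1).
Proof.
move=> sE; have [ia sb ba ex] := sE => -[h hE].
(* The extension [h] of the pullback of [eta], restricted to the kernel resolution, vanishes on the
   next syzygy, since [eta \o syz_map b i.+1] does so on the kernel of [syz_map b i.+1]. *)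
have [z0 z0E] : exists z0 : {linear rS (ker_resol sb) i -> M},
    forall x, z0 (rp (ker_resol sb) i x) = h (val x).
  apply: (@lin_factor_surj R _ _ _ (rp (ker_resol sb) i)
    (h \o (val : rP (ker_resol sb) i -> free_res B i))); first exact: rp_surj.
  move=> x /r_exact[y ->] /=; rewrite -[X in h X]/(syz_incl B i (val y)).
  by rewrite -hE /= (eqP (valP y)) linear0.
have [g0 g0E] := short_exact_ker_resolV sb sE.
have [s [ls s0]] := @lift_exists R (free_resol K) (ker_resol sb) g0.
exists (z0 \o s i) => K' B' C' a' b' k f c sE' sq1 sq2 zk.
have [_ sb' _ _] := sE'.
have fk j x : x \in ker_sub (syz_map b' j) -> syz_map f j x \in ker_sub (syz_map b j).
  rewrite !unfold_in => /eqP x0.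
  by rewrite (syz_map_square sq2) x0 linear0.
have fP j x : x \in ker_sub (res_map b' j) -> res_map f j x \in ker_sub (res_map b j).
  rewrite !unfold_in => /eqP x0; rewrite /res_map.
  have -> : free_map (syz_map b j) (free_map (syz_map f j) x) =
            free_map (syz_map c j) (free_map (syz_map b' j) x).
    apply: (@free_hom_ext R _ _ (free_map (syz_map b j) \o free_map (syz_map f j))
      (free_map (syz_map c j) \o free_map (syz_map b' j))) => y /=.
    by rewrite !free_mapU (syz_map_square sq2).
  by rewrite -/(res_map b' j) x0 linear0.
pose kap j : {linear rS (ker_resol sb') j -> rS (ker_resol sb) j} := subm_map (fk j).
have lkap : @is_lift R (ker_resol sb') (ker_resol sb) kap.
  move=> j; exists (subm_map (fP j)); split=> x; apply: val_inj => //.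
  exact: aug_free_map.
have [f0 f0E] := short_exact_ker_resol sb' sE'.
have [t [lt t0]] := @lift_exists R (ker_resol sb') (free_resol K') f0.
have zkap : triv (z0 \o kap i).
  apply: (triv_lift_uniq lkap (lift_comp lt (lift_comp (syz_map_lift k) ls))).
    by move=> x; apply: val_inj; rewrite /= s0 t0 -[RHS]/(ker_resol_val sb 0 (g0 (k (f0 x))))
      g0E sq1 f0E.
  exact: (triv_lift lt zk).
have [e [_ eE]] := ker_resol_triv_extend zkap.
(* The two terms agree on the kernel of [res_map b' i], so their difference descends to
   [free_res C' i]. On the next syzygy the term through [aug] vanishes, and [l] restricts to the
   pullback of [eta]. *)
have [||l lE] := @lin_factor_surj R _ _ _ (res_map b' i)
    ((h \o res_map f i) \- (e \o aug (syz B' i))).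
- by apply: free_map_surj; exact: syz_map_surj.
- move=> x x0; have xk : x \in ker_sub (res_map b' i) by rewrite unfold_in x0.
  have := eE (rp (ker_resol sb') i (insubm xk)); rewrite /= => ->.
  have := z0E (insubm (fP i x xk)) => /= <-.
  apply/eqP; rewrite subr_eq0; apply/eqP; congr (z0 _); apply: val_inj => /=.
  exact: aug_free_map.
exists l => z; have [w <-] := @syz_map_surj R B' C' b' i.+1 sb' z.
rewrite -[LHS]/(eta (syz_map c i.+1 (syz_map b' i.+1 w))) -(syz_map_square sq2).
rewrite -[LHS]/((eta \o syz_map b i.+1) (syz_map f i.+1 w)) hE.
have := lE (syz_incl B' i w); rewrite /= => ->.
have /eqP -> := valP w.
by rewrite linear0 subr0.
Qed.

End ShortExact.

Section Quotients.
Variables (R : comNzRingType) (V : lmodType R) (N : submodClosed V).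

Lemma quom_pi_eq0 x : quom_pi N x = 0 <-> x \in N.
Proof.
rewrite -[in X in _ <-> X](subr0 x) -quom_eq -/(quom_pi N x) -/(quom_pi N 0) linear0.
by split=> [->|/eqP].
Qed.

Lemma quom_pi_eq x y : quom_pi N x = quom_pi N y <-> x - y \in N.
Proof. by rewrite -quom_eq; split=> [xy|/eqP //]; apply/eqP. Qed.

Lemma quom_piE (y : quom N) : exists x, y = quom_pi N x.
Proof. by exists (repr y); rewrite /quom_pi reprK. Qed.

End Quotients.

(** * Local cohomology classes *)

Section ExtClasses.
Variable R : comNzRingType.
Implicit Types N M : lmodType R.

Fact cls_linear N M i (g : {linear syz N i -> M}) :
  (g \o aug (syz N i) : free_res N i -> M) \in @hom_pred R (free_res N i) M.
Proof. by apply/asboolP => a u v /=; rewrite !linearP. Qed.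

Fact cls_cocycle N M i (g : {linear syz N i -> M}) :
  (insubm (cls_linear g) : cochain N M i) \in cocycles i N M.
Proof.
rewrite unfold_in; apply/eqP/val_inj/funext => x /=.
apply: etrans (linear0 g); congr (g _).
exact: (eqP (valP (aug (syz N i.+1) x))).
Qed.

Definition cls N M i (g : {linear syz N i -> M}) : Ext i N M :=
  quom_pi _ (insubm (cls_cocycle g)).

(** A cocycle on the i-th free module kills the image of the next one, which is the kernel of the
    augmentation, so it factors through the i-th syzygy. *)
Lemma cls_surj N M i (xi : Ext i N M) : exists g : {linear syz N i -> M}, xi = cls g.
Proof.
have [z ->] := quom_piE xi; pose f : {linear free_res N i -> M} := hom_fun (val z).
have [||g gE] := @lin_factor_surj R _ _ _ (aug (syz N i)) f.
- exact: aug_surj.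
- move=> x x0; have /eqP/(congr1 val)/= zc := valP z.
  have [y ->] := @can_exact R N i x x0.
  have [w <-] := @aug_surj R (syz N i.+1) y.
  exact: (congr1 (fun f => f w) zc).
exists g; congr quom_pi; apply: val_inj; apply: val_inj; apply/funext => x /=.
by rewrite gE.
Qed.

Lemma cls_eq0 N M i (g : {linear syz N i -> M}) :
  cls g = 0 <-> @triv R (free_resol N) i M g.
Proof.
rewrite quom_pi_eq0 unfold_in /=; case: i g => [|i] g /=.
  rewrite unfold_in; split=> [/eqP/(congr1 val) g0 x|g0].
    have [w <-] := @aug_surj R N x; exact: (congr1 (fun f => f w) g0).
  by apply/eqP/val_inj/funext => x /=; rewrite g0.
split=> [/asboolP[h /(congr1 val) hE]|[h hE]].
  exists (hom_fun h) => x; have [w <-] := @aug_surj R (syz N i.+1) x.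
  exact: (congr1 (fun f => f w) hE).
apply/asboolP; have lh : (h : free_res N i -> M) \in @hom_pred R (free_res N i) M.
  by apply/asboolP => a u v; rewrite linearP.
by exists (insubm lh); apply/val_inj/funext => x /=; rewrite hE.
Qed.

Lemma cls_lin N M i r (g g' : {linear syz N i -> M}) :
  cls (r \*: g \+ g') = r *: cls g + cls g'.
Proof.
rewrite -linearP; congr quom_pi; apply: val_inj; apply: val_inj.
by apply/funext => x /=.
Qed.

Lemma Ext_map_cls N N' M i (f : {linear N -> N'}) (g : {linear syz N' i -> M}) :
  Ext_map i M f (cls g) = cls (g \o syz_map f i).
Proof.
apply: etrans (quom_map_pi _ _) _; congr quom_pi; apply: val_inj; apply: val_inj.
apply/funext => x /=; congr (g _).
exact: (aug_free_map (syz_map f i) x).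
Qed.

End ExtClasses.

(** * Sequential direct limits *)

Section DirectLimits.
Variables (R : comNzRingType) (D : nat -> lmodType R).
Variable f : forall n, {linear D n -> D n.+1}.

Local Notation sum_in := (@dsum_in R D).
Definition dl_in n (x : D n) : dirlim f := quom_pi _ (sum_in x).

(* The image in [D N] of the components of index [< N]. *)
Fixpoint dl_fold (N : nat) (y : dsum D) : D N :=
  match N with 0 => 0 | n.+1 => f n (dl_fold n y + val y n) end.

Lemma dl_fold_lin N a y z : dl_fold N (a *: y + z) = a *: dl_fold N y + dl_fold N z.
Proof.
elim: N => [|N IH] /=; first by rewrite scaler0 addr0.
rewrite IH -linearP; congr (f N _).
by rewrite scalerDr addrACA.
Qed.

Fixpoint dl_trans n (x : D n) k : D (k + n) :=
  match k return D (k + n) with 0 => x | k'.+1 => f (k' + n) (dl_trans x k') end.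

Lemma dsum_in_lin n a (x y : D n) : sum_in (a *: x + y) = a *: sum_in x + sum_in y.
Proof.
apply: val_inj; apply: functional_extensionality_dep => k /=.
rewrite -[RHS]/(a *: val (sum_in x) k + val (sum_in y) k) /=.
case: dfwithP => [|j nj]; first by rewrite !dfwith_in.
by rewrite !dfwith_out // scaler0 addr0.
Qed.

Lemma dl_in_lin n a (x y : D n) : dl_in (a *: x + y) = a *: dl_in x + dl_in y.
Proof. by rewrite /dl_in dsum_in_lin linearP. Qed.

Lemma dl_in_step n (x : D n) : dl_in (f n x) = dl_in x.
Proof.
apply/eqP; rewrite eq_sym quom_eq; apply/asboolP => N; apply.
by exists n, x.
Qed.

Lemma dl_in_trans n (x : D n) k : dl_in (dl_trans x k) = dl_in x.
Proof. by elim: k => //= k IH; rewrite dl_in_step. Qed.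

Lemma dl_surj (z : dirlim f) : exists n (x : D n), z = dl_in x.
Proof.
have [y ->] := quom_piE z.
suff H N' : forall y : dsum D, (forall n, (N' <= n)%N -> val y n = 0) ->
    exists x : D N', quom_pi _ y = dl_in x.
  have /asboolP fy := valP y.
  have [N' yN] : exists N', forall n, (N' <= n)%N -> val y n = 0.
    have /finite_seqP[s sE] := fy.
    exists (\max_(n <- s) n.+1) => n; case: (eqVneq (val y n) 0) => // y0 le.
    have ns : n \in s by have := y0; rewrite -[is_true _]/([set n | val y n != 0]%classic n) sE.
    by have := leq_trans (@leq_bigmax_seq _ s predT (fun n => n.+1) n ns isT) le; rewrite ltnn.
  by have [x ->] := H N' y yN; exists N', x.
elim: N' => [|n IH] {}y y0.
  exists 0; congr quom_pi; apply: val_inj; apply: functional_extensionality_dep => k.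
  rewrite y0 //=; by case: dfwithP.
have [|x xE] := IH (y - sum_in (val y n)).
  move=> k; rewrite -[val _ k]/(val y k - val (sum_in (val y n)) k) leq_eqVlt /=.
  move=> /orP[/eqP <-|nk]; first by rewrite dfwith_in subrr.
  rewrite dfwith_out ?y0 ?subrr //.
  by rewrite neq_ltn nk.
exists (f n x + f n (val y n)).
by rewrite -[X in X + _]scale1r dl_in_lin scale1r !dl_in_step -xE linearB subrK.
Qed.

Lemma dl_fold_eq0 N m (y : dsum D) : (m <= N)%N -> dl_fold m y = 0 ->
  (forall j, (m <= j < N)%N -> val y j = 0) -> dl_fold N y = 0.
Proof.
move=> mN y0; elim: N mN => [|N IH]; first by rewrite leqn0 => /eqP <-.
rewrite leq_eqVlt => /orP[/eqP <- //|mN] yj.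
rewrite /= IH ?yj ?addr0 ?linear0 // ?leqnn ?andbT // => j /andP[mj jN].
by rewrite yj // mj ltnS (ltnW jN).
Qed.

Lemma dl_fold_in n (x : D n) k : dl_fold (k.+1 + n) (sum_in x) = dl_trans x k.+1.
Proof.
elim: k => [|k IH] /=.
  rewrite (@dl_fold_eq0 n 0) ?dfwith_in ?add0r // => j /andP[_ jn].
  by rewrite /= dfwith_out // neq_ltn jn orbT.
rewrite /= in IH; rewrite IH dfwith_out ?addr0 //.
by rewrite neq_ltn ltnS leq_addl.
Qed.

Lemma dl_in_eq0 n (x : D n) : dl_in x = 0 <-> exists k, dl_trans x k = 0.
Proof.
split; last first.
  case=> k x0; rewrite -(dl_in_trans x k) x0 -(subrr 0) -scaleN1r addrC dl_in_lin.
  by rewrite scaleN1r addNr.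
rewrite /dl_in quom_pi_eq0.
(* Eventual vanishing of the folds is a submodule condition satisfied by the defining relations of
   the limit; on a single component [x] the folds are the transition images of [x]. *)
pose Q (y : dsum D) := exists N0, forall N, (N0 <= N)%N -> dl_fold N y = 0.
have QP : Q 0 /\ forall a u v, Q u -> Q v -> Q (a *: u + v).
  split.
    exists 0%N => N _; have := dl_fold_lin N (-1) 0 0.
    by rewrite scaler0 addr0 scaleN1r addNr.
  move=> a u v [n1 h1] [n2 h2]; exists (maxn n1 n2) => N; rewrite geq_max => /andP[a1 a2].
  by rewrite dl_fold_lin h1 // h2 // scaler0 addr0.
move=> /asboolP/(_ (psub QP)) genP.
have {genP}/psubP[N0 xN0] : sum_in x \in psub QP.
  (* The relation has components at p and p+1, and [dl_fold N] sees only indices below N: [p.+2] is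
     the first fold where both occur and cancel. *)
  apply: genP => _ [p [z ->]]; apply/psubP; exists p.+2 => N pN.
  pose y := sum_in z - sum_in (f p z); rewrite -/y.
  have yE j : val y j = val (sum_in z) j - val (sum_in (f p z)) j by [].
  apply: (dl_fold_eq0 pN) => [|j /andP[pj _]].
    rewrite -[LHS]/(f p.+1 (f p (dl_fold p y + val y p) + val y p.+1)).
    rewrite (@dl_fold_eq0 p 0) // ?add0r => [|j /andP[_ jp]].
      rewrite !yE /= !dfwith_in !dfwith_out ?neq_ltn ?ltnSn ?orbT //.
      by rewrite subr0 sub0r subrr linear0.
    by rewrite yE /= !dfwith_out ?subrr // neq_ltn ?ltnS ?jp ?(ltnW jp) ?orbT.
  by rewrite yE /= !dfwith_out ?subrr // neq_ltn ?pj // (ltnW pj).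
by exists N0.+1; rewrite -dl_fold_in xN0 // ltnW ?leq_addr.
Qed.

End DirectLimits.

(** * Powers of ideals, sums with a principal ideal, colon ideals *)

Section IdealPowers.
Variable R : comNzRingType.
Implicit Types (a b I J K : ideal R) (M X Y : lmodType R).

Lemma ideal_mul I r x : x \in I -> r * x \in I.
Proof. exact: (@rpredZ _ _ I r x). Qed.

Lemma ideal0 I : (0 : R) \in I.
Proof. exact: (@rpred0 _ I). Qed.

Lemma idealD I (x y : R) : x \in I -> y \in I -> x + y \in I.
Proof. exact: (@rpredD _ I x y). Qed.

Lemma gen_sub_ind (V : lmodType R) (S : set V) (N : submodClosed V) x :
  (forall s, S s -> s \in N) -> x \in gen_sub S -> x \in N.
Proof. by move=> SN /asboolP; apply. Qed.

Lemma mem_gen_sub (V : lmodType R) (S : set V) s : S s -> s \in gen_sub S.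
Proof. by move=> Ss; apply/asboolP => N; apply. Qed.

Lemma ideal_expS a n r x : r \in a -> x \in ideal_exp a n -> r * x \in ideal_exp a n.+1.
Proof. by move=> ra xn; apply: mem_gen_sub; exists r, x. Qed.

Lemma ideal_exp_ind a n J :
  (forall r x, r \in a -> x \in ideal_exp a n -> r * x \in J) ->
  {subset ideal_exp a n.+1 <= J}.
Proof. by move=> h x; apply: gen_sub_ind => _ [r [z [ra zn ->]]]; exact: h. Qed.

Lemma ideal_exp_antimono a m n : (m <= n)%N -> {subset ideal_exp a n <= ideal_exp a m}.
Proof.
elim: n => [|n IH]; first by rewrite leqn0 => /eqP ->.
rewrite leq_eqVlt => /orP[/eqP -> //|mn] x /ideal_act_sub; exact: IH.
Qed.

Lemma ideal_exp_mono a b n : {subset a <= b} -> {subset ideal_exp a n <= ideal_exp b n}.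
Proof.
move=> ab; elim: n => [|n IH] //; apply: ideal_exp_ind => r x ra xn.
by apply: ideal_expS; [exact: ab|exact: IH].
Qed.

Lemma ideal_exp_pow a n y : y \in a -> y ^+ n \in ideal_exp a n.
Proof. by move=> ya; elim: n => // n IH; rewrite exprS; exact: ideal_expS. Qed.

Section AddGenerator.
Variables (I : ideal R) (y : R).
Fact addp_closed : (exists u r, u \in I /\ (0 : R^o) = u + r * y) /\
  forall (c : R) (x z : R^o), (exists u r, u \in I /\ x = u + r * y) ->
  (exists u r, u \in I /\ z = u + r * y) ->
  exists u r, u \in I /\ (c *: x + z : R^o) = u + r * y.
Proof.
split; first by exists 0, 0; rewrite ideal0 mul0r addr0.
move=> c x z [u [r [uI ->]]] [u' [r' [uI' ->]]].
exists (c *: u + u'), (c * r + r'); split; first by rewrite idealD ?ideal_mul.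
by rewrite scalerDr addrACA mulrDl -mulrA.
Qed.
Definition ideal_addp : ideal R := psub addp_closed.

Lemma ideal_addpP x : x \in ideal_addp <-> exists u r, u \in I /\ x = u + r * y.
Proof. by split=> [/psubP|h]; last exact/psubP. Qed.

Lemma ideal_addpl : {subset I <= ideal_addp}.
Proof. by move=> x xI; apply/ideal_addpP; exists x, 0; rewrite mul0r addr0. Qed.

Lemma ideal_addpr r : r * y \in ideal_addp.
Proof. by apply/ideal_addpP; exists 0, r; rewrite ideal0 add0r. Qed.

Fact colon_closed : y * 0 \in I /\
  forall (c : R) (u v : R^o), y * u \in I -> y * v \in I -> y * (c *: u + v : R^o) \in I.
Proof.
split; first by rewrite mulr0 ideal0.
move=> c u v yu yv; rewrite mulrDr; apply: idealD => //.
by rewrite -[c *: u]/(c * u) mulrCA ideal_mul.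
Qed.
Definition ideal_colon : ideal R := @psub R R^o (fun x => y * x \in I) colon_closed.

Lemma ideal_colonP x : (x \in ideal_colon) = (y * x \in I).
Proof. by apply/idP/idP => [/psubP|h] //; apply/psubP. Qed.

End AddGenerator.

(** Pigeonhole: among n + m factors, n come from a or m are multiples of y. In the induction, the
    two summands of the leading factor raise one exponent each. *)
Lemma ideal_exp_addp a y n m :
  {subset ideal_exp (ideal_addp a y) (n + m) <= ideal_addp (ideal_exp a n) (y ^+ m)}.
Proof.
move: n m; suff H k : forall n m, (n + m)%N = k ->
    {subset ideal_exp (ideal_addp a y) k <= ideal_addp (ideal_exp a n) (y ^+ m)}.
  by move=> n m; exact: H.
elim: k => [|k IH] [|n] [|m] // nmk x; rewrite ?addn0 ?addSn in nmk.
- by move=> _; apply/ideal_addpP; exists x, 0; rewrite mul0r addr0.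
- by move=> _; apply/ideal_addpP; exists x, 0; rewrite mul0r addr0.
- by move=> _; apply/ideal_addpP; exists 0, x; rewrite ideal0 expr0 mulr1 add0r.
- move: x; apply: ideal_exp_ind => r x /ideal_addpP[u [s [ua ->]]] xk.
  rewrite mulrDl idealD //.
    have [|v [t [va ->]]] := iffLR (ideal_addpP _ _ _) (IH n m.+1 _ x xk).
      by case: nmk.
    by apply/ideal_addpP; exists (u * v), (u * t); rewrite ideal_expS // mulrDr mulrA.
  have [|v [t [va ->]]] := iffLR (ideal_addpP _ _ _) (IH n.+1 m _ x xk).
    by case: nmk => <-; rewrite addnS.
  apply/ideal_addpP; exists (s * y * v), (s * t); rewrite ideal_mul // mulrDr exprS.
  by rewrite !mulrA (mulrAC s y t).
Qed.

End IdealPowers.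

(** * Multiplication maps between cyclic modules *)

Section MultiplicationMaps.
Variable R : comNzRingType.
Implicit Types (a b I J K : ideal R) (M X Y : lmodType R).

(** This specification determines the map, so composites and squares of maps between cyclic modules
    are compared through their multipliers alone. *)
Definition mulby I J (r : R) (f : quom I -> quom J) :=
  forall x : R, f (quom_pi I x) = quom_pi J (r * x).

Lemma mulby_ex I J r : (forall x, x \in I -> r * x \in J) ->
  exists f : {linear quom I -> quom J}, mulby r f.
Proof.
move=> h; have lr : linear (fun x : R^o => r * x : R^o).
  by move=> c u v; rewrite mulrDr -[c *: u]/(c * u) mulrCA.
by exists (quom_map (f := mklin lr) h) => x; rewrite [LHS]quom_map_pi.
Qed.

Lemma sub_mulby I J : {subset I <= J} -> exists f : {linear quom I -> quom J}, mulby 1 f.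
Proof. by move=> IJ; apply: mulby_ex => x; rewrite mul1r; exact: IJ. Qed.

Lemma mulby_eq I J r s (f f' : {linear quom I -> quom J}) c :
  mulby r f -> mulby s f' -> r = c * s -> forall x, f x = c *: f' x.
Proof.
move=> fr fs rcs x; have [z ->] := quom_piE x.
by rewrite fr fs rcs -linearZ /= -[_ *: _]/(c * (s * z)) mulrA.
Qed.

(** [syz_map] is not linear in its map, because basis vectors go to basis vectors. Multiplying a
    lift of [f'] by [c] nevertheless gives a lift of [f], so the two pullbacks agree up to a trivial
    class. *)
Lemma triv_scale i I J M c (f f' : {linear quom I -> quom J})
    (g : {linear syz (quom J) i -> M}) : (forall x, f x = c *: f' x) ->
  @triv R (free_resol (quom I)) i M (g \o syz_map f i) <->
  @triv R (free_resol (quom I)) i M (c \*: (g \o syz_map f' i)).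
Proof.
move=> ff; have := lift_uniq (syz_map_lift f)
  (lift_comp (syz_map_lift f') (@lift_scale R (free_resol (quom J)) c)) ff i.
move=> /(triv_post g) d; split=> t.
  by apply: triv_ext (triv_lin (-1) d t) => x /=; rewrite linearB linearZ scaleN1r opprB subrK.
by apply: triv_ext (triv_lin 1 d t) => x /=; rewrite linearB linearZ scale1r subrK.
Qed.

Lemma triv_mulby i I J M r (f f' : {linear quom I -> quom J})
    (g : {linear syz (quom J) i -> M}) : mulby r f -> mulby 1 f' ->
  @triv R (free_resol (quom I)) i M (g \o syz_map f i) <->
  @triv R (free_resol (quom I)) i M (r \*: (g \o syz_map f' i)).
Proof. by move=> fr f1; apply: triv_scale; apply: mulby_eq fr f1 _; rewrite mulr1. Qed.

Lemma triv_mulby_comp i I J K M r s (f : {linear quom I -> quom J})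
    (f' : {linear quom J -> quom K}) (h : {linear quom I -> quom K})
    (g : {linear syz (quom K) i -> M}) : mulby r f -> mulby s f' -> mulby (s * r) h ->
  @triv R (free_resol (quom I)) i M (g \o syz_map h i) <->
  @triv R (free_resol (quom I)) i M (g \o syz_map f' i \o syz_map f i).
Proof.
move=> fr fs hsr; apply: triv_syz_comp => x; have [z ->] := quom_piE x.
by rewrite hsr fr fs mulrA.
Qed.

Lemma triv_sub_comp i I J K M (f : {linear quom I -> quom J})
    (f' : {linear quom J -> quom K}) (h : {linear quom I -> quom K})
    (g : {linear syz (quom K) i -> M}) : mulby 1 f -> mulby 1 f' -> mulby 1 h ->
  @triv R (free_resol (quom I)) i M (g \o syz_map h i) <->
  @triv R (free_resol (quom I)) i M (g \o syz_map f' i \o syz_map f i).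
Proof. by move=> f1 f1' h1; apply: triv_mulby_comp f1 f1' _; rewrite mulr1. Qed.

Lemma triv_sub_square i I J J' K M (f : {linear quom I -> quom J})
    (f' : {linear quom J -> quom K}) (h : {linear quom I -> quom J'})
    (h' : {linear quom J' -> quom K}) (g : {linear syz (quom K) i -> M}) :
  mulby 1 f -> mulby 1 f' -> mulby 1 h -> mulby 1 h' ->
  @triv R (free_resol (quom I)) i M (g \o syz_map f' i \o syz_map f i) ->
  @triv R (free_resol (quom I)) i M (g \o syz_map h' i \o syz_map h i).
Proof.
move=> f1 f1' h1 h1'.
have [k k1] : exists k : {linear quom I -> quom K}, mulby 1 k.
  by exists (f' \o f) => x; rewrite /= f1 f1' !mul1r.
by move=> /(triv_sub_comp g f1 f1' k1) /(triv_sub_comp g h1 h1' k1).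
Qed.

End MultiplicationMaps.

(** * Representatives of local cohomology classes *)

Section LocalCohomologyClasses.
Variables (R : comNzRingType) (a : ideal R) (i : nat) (M : lmodType R).

Local Notation H := (local_cohomology a i M).
Local Notation E n := (quom (ideal_exp a n)).

Lemma cls_eq N (g g' : {linear syz N i -> M}) :
  @triv R (free_resol N) i M (fun x => g x - g' x) -> cls g = cls g'.
Proof.
move=> t; apply/eqP; rewrite eq_sym -subr_eq0 addrC -scaleN1r -cls_lin; apply/eqP/cls_eq0.
by apply: triv_ext (trivZ (-1) t) => x /=; rewrite scalerBr !scaleN1r opprK.
Qed.

Definition lc n (g : {linear syz (E n) i -> M}) : H :=
  @dl_in R (fun n => Ext i (quot_exp a n) M) (fun n => Ext_map i M (quot_exp_proj a n)) n (cls g).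

Lemma lc_surj (xi : H) : exists n (g : {linear syz (E n) i -> M}), xi = lc g.
Proof. by have [n [x ->]] := dl_surj xi; have [g ->] := cls_surj x; exists n, g. Qed.

Lemma lc_lin n r (g g' : {linear syz (E n) i -> M}) : lc (r \*: g \+ g') = r *: lc g + lc g'.
Proof. by rewrite /lc cls_lin dl_in_lin. Qed.

Lemma lc_ext n (g g' : {linear syz (E n) i -> M}) : g =1 g' -> lc g = lc g'.
Proof. 
move=> gg; congr dl_in; congr quom_pi; apply: val_inj; apply: val_inj.
by apply/funext => x /=; rewrite gg.
Qed.

Lemma lc_triv_eq n (g g' : {linear syz (E n) i -> M}) :
  @triv R (free_resol (E n)) i M (fun x => g x - g' x) -> lc g = lc g'.
Proof. by move=> /cls_eq gg; rewrite /lc gg. Qed.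

Lemma lc_trans n (g : {linear syz (E n) i -> M}) k :
  exists p : {linear E (k + n) -> E n}, mulby 1 p /\
  (@dl_trans R (fun n => Ext i (quot_exp a n) M) (fun n => Ext_map i M (quot_exp_proj a n)) n (cls g) k = 0
    <-> @triv R (free_resol (E (k + n))) i M (g \o syz_map p i)).
Proof.
suff [p [p1 pE]] : exists p : {linear E (k + n) -> E n}, mulby 1 p /\
  @dl_trans R (fun n => Ext i (quot_exp a n) M) (fun n => Ext_map i M (quot_exp_proj a n)) n (cls g) k
    = cls (g \o syz_map p i).
  by exists p; split=> //; rewrite pE cls_eq0.
elim: k => [|k [p [p1 pE]]].
  exists idfun; split=> [x /=|]; first by rewrite mul1r.
  apply: cls_eq; apply: triv_ext (triv_post g (lift_uniq (@lift_id R (free_resol (E n)))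
    (syz_map_lift (idfun : {linear E n -> E n})) (fun=> erefl) i)) => x /=.
  by rewrite linearB.
exists (p \o quot_exp_proj a (k + n)); split=> [x|].
  by rewrite /= [quot_exp_proj a _ _]quom_map_pi p1.
rewrite [LHS]/= pE Ext_map_cls; apply: cls_eq.
apply: triv_ext (triv_post g (lift_uniq (lift_comp (syz_map_lift (quot_exp_proj a (k + n)))
  (syz_map_lift p)) (syz_map_lift (p \o quot_exp_proj a (k + n))) (fun=> erefl) i)) => x /=.
by rewrite linearB.
Qed.

Lemma lc_eq0 n (g : {linear syz (E n) i -> M}) : lc g = 0 <->
  exists N (f : {linear E N -> E n}), mulby 1 f /\ @triv R (free_resol (E N)) i M (g \o syz_map f i).
Proof.
rewrite /lc dl_in_eq0; split.
  by case=> k; have [p [p1 pE]] := lc_trans g k => /pE t; exists (k + n)%N, p.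
(* N may be smaller than n; the class is therefore tested over the exponent N + n, which maps to
   both. *)
case=> N [f [f1 t]]; exists N; have [p [p1 pE]] := lc_trans g N; apply/pE.
have [q q1] := @sub_mulby R _ _ (@ideal_exp_antimono _ a _ _ (leq_addr n N)).
by apply/(triv_sub_comp g q1 f1 p1); exact: triv_lift (syz_map_lift q) t.
Qed.

Lemma lcZ n r (g : {linear syz (E n) i -> M}) : lc (r \*: g) = r *: lc g.
Proof.
have z0 : lc (\0 : {linear syz (E n) i -> M}) = 0.
  apply/lc_eq0; exists n, idfun; split=> [x|]; first by rewrite mul1r.
  exact: triv_ext (triv0 (free_resol (E n)) i M).
by rewrite -[RHS]addr0 -z0 -lc_lin; apply: lc_ext => x /=; rewrite addr0.
Qed.

Lemma lc_scale_eq0 n r (g : {linear syz (E n) i -> M}) : r *: lc g = 0 <->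
  exists N (f : {linear E N -> E n}),
    mulby 1 f /\ @triv R (free_resol (E N)) i M (r \*: (g \o syz_map f i)).
Proof.
rewrite -lcZ lc_eq0; split=> -[N [f [f1 t]]]; exists N, f; split=> //.
Qed.

Lemma lc_scale_eq0_large n r (g : {linear syz (E n) i -> M}) : r *: lc g = 0 ->
  exists N0, forall N (f : {linear E N -> E n}), (N0 <= N)%N -> mulby 1 f ->
    @triv R (free_resol (E N)) i M (r \*: (g \o syz_map f i)).
Proof.
move=> /lc_scale_eq0[N0 [f0 [f01 t]]]; exists N0 => N f NN f1.
have [q q1] := sub_mulby (@ideal_exp_antimono _ a _ _ NN).
have := triv_lift (syz_map_lift q) t => {}t.
by apply/(triv_sub_comp (r \*: g) q1 f01 f1).
Qed.

Lemma lc_sub_scale N n r (f : {linear E N -> E n}) (g : {linear syz (E n) i -> M}) :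
  mulby 1 f -> r *: lc (g \o syz_map f i) = 0 <-> r *: lc g = 0.
Proof.
move=> f1; split=> [/lc_scale_eq0[k [h [h1 t]]]|/lc_scale_eq0_large[N0 t]].
  apply/lc_scale_eq0; exists k, (f \o h); split=> [x|]; first by rewrite /= h1 f1 !mul1r.
  apply/(triv_sub_comp (r \*: g) h1 f1 _) => // x.
  by rewrite /= h1 f1 !mul1r.
have [h h1] := sub_mulby (@ideal_exp_antimono _ a _ _ (leq_addl N0 N)).
apply/lc_scale_eq0; exists (N0 + N)%N, h; split=> //.
have [p p1] : exists p : {linear E (N0 + N) -> E n}, mulby 1 p.
  by exists (f \o h) => x; rewrite /= h1 f1 !mul1r.
by apply/(triv_sub_comp (r \*: g) h1 f1 p1); exact: t (leq_addr _ _) p1.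
Qed.

(** Multiplication by [r] on the class is induced by multiplication by [r] on R/a^n, which is the
    zero map. *)
Lemma lc_torsion n (g : {linear syz (E n) i -> M}) r : r \in ideal_exp a n -> r *: lc g = 0.
Proof.
move=> rn; apply/lc_scale_eq0; exists n, idfun.
have i1 : mulby 1 (idfun : {linear E n -> E n}) by move=> x; rewrite mul1r.
split=> //; apply/(triv_mulby (f := (\0 : {linear E n -> E n})) g _ i1).
  move=> x; apply/esym/quom_pi_eq0; rewrite mulrC; exact: ideal_mul.
apply/(@triv_scale _ i _ _ M 0 \0 idfun g) => [x|]; first by rewrite scale0r.
by apply: triv_ext (triv0 (free_resol (E n)) i M) => x /=; rewrite scale0r.
Qed.

End LocalCohomologyClasses.

(** * Adding one element to the ideal *)

Section AddOneElement.
Variable R : comNzRingType.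
Implicit Types (a I J : ideal R) (M X Y Z : lmodType R).

(** A substitute for an embedding of X into Y that asks for no map: it still carries associated
    primes of X to Y, and Y = 0 forces X = 0. *)
Definition ann_sub X Y := forall x : X, exists y : Y, forall r, r *: x = 0 <-> r *: y = 0.

(** The vanishing of the localization X_y. *)
Definition power_torsion X (y : R) := forall x : X, exists l, y ^+ l *: x = 0.

Definition colon_stable a (y : R) := forall n, exists m0, forall m, (m0 <= m)%N ->
  {subset ideal_colon (ideal_exp a n) (y ^+ m) <= ideal_colon (ideal_exp a n) (y ^+ m0)}.

Lemma colon_mulby I y : exists f : {linear quom (ideal_colon I y) -> quom I}, mulby y f.
Proof. by apply: mulby_ex => x; rewrite ideal_colonP. Qed.

Lemma sub_colon I y : {subset I <= ideal_colon I y}.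
Proof. by move=> x xI; rewrite ideal_colonP ideal_mul. Qed.

Lemma short_exact_colon I y (f : {linear quom (ideal_colon I y) -> quom I})
    (g : {linear quom I -> quom (ideal_addp I y)}) :
  mulby y f -> mulby 1 g -> short_exact f g.
Proof.
move=> fy g1; split.
- move=> u v; have [u' ->] := quom_piE u; have [v' ->] := quom_piE v.
  move=> /eqP; rewrite -subr_eq0 -linearB -linearB fy => /eqP/quom_pi_eq0 h.
  by apply/eqP; rewrite -subr_eq0 -linearB; apply/eqP/quom_pi_eq0; rewrite ideal_colonP.
- by move=> u; have [x ->] := quom_piE u; exists (quom_pi _ x); rewrite g1 mul1r.
- move=> u; have [x ->] := quom_piE u; rewrite fy g1 mul1r mulrC.
  by apply/quom_pi_eq0; exact: ideal_addpr.
- move=> u; have [x ->] := quom_piE u; rewrite g1 mul1r => /quom_pi_eq0.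
  move=> /ideal_addpP[v [r [vI ->]]]; exists (quom_pi (ideal_colon I y) r); rewrite fy.
  by apply/quom_pi_eq; rewrite (mulrC y) addrK.
Qed.

Variables (a : ideal R) (y : R) (M : lmodType R).
Hypothesis stab : colon_stable a y.

Local Notation H i := (local_cohomology a i M).
Local Notation a' := (ideal_addp a y).
Local Notation H' i := (local_cohomology a' i M).
Local Notation E n := (quom (ideal_exp a n)).
Local Notation E' n := (quom (ideal_exp a' n)).

Let pow_colon_sub I J m n : {subset I <= J} -> (n <= m)%N ->
  forall x, x \in ideal_colon I (y ^+ m) -> y ^+ (m - n) * x \in ideal_colon J (y ^+ n).
Proof. by move=> IJ nm x; rewrite !ideal_colonP mulrA -exprD subnKC // => /IJ. Qed.

Let y_a' : y \in a'.
Proof. by have := ideal_addpr a y 1; rewrite mul1r. Qed.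

Let addp_sub_pow n k m : (n <= k)%N -> (n <= m)%N ->
  {subset ideal_addp (ideal_exp a k) (y ^+ m) <= ideal_exp a' n}.
Proof.
move=> nk nm x /ideal_addpP[u [r [uk ->]]]; apply: idealD.
  exact: ideal_exp_antimono nk _ (ideal_exp_mono (@ideal_addpl _ a y) uk).
by apply: ideal_mul; exact: ideal_exp_antimono nm _ (ideal_exp_pow m y_a').
Qed.

Let addp_sub_addp k k' m m' : (k' <= k)%N -> (m' <= m)%N ->
  {subset ideal_addp (ideal_exp a k) (y ^+ m) <= ideal_addp (ideal_exp a k') (y ^+ m')}.
Proof.
move=> kk mm x /ideal_addpP[u [r [uk ->]]]; apply/ideal_addpP.
exists u, (r * y ^+ (m - m')); split; first exact: ideal_exp_antimono kk _ uk.
by rewrite -mulrA -exprD subnK.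
Qed.

(** A class that dies over R/a^k comes from some [zeta] in Ext^i(R/(a^k : y^n), M), and raising both
    exponents kills [zeta] because H^i_a(M) is y-power torsion. This is the injectivity of
    H^(i+1)_(a+Ry)(M) -> H^(i+1)_a(M). *)
Lemma lc_addp_inj i n k (g : {linear syz (E' n) i.+1 -> M}) (f : {linear E k -> E' n}) :
  power_torsion (H i) y -> mulby 1 f ->
  @triv R (free_resol (E k)) i.+1 M (g \o syz_map f i.+1) -> lc g = 0.
Proof.
move=> tors.
(* For n <= k the ideal a^k + y^n R lies in the n-th power of a + Ry, so [g] can be pulled back to
   its quotient. *)
wlog nk : k f / (n <= k)%N.
  move=> WL f1 t; have [q q1] := sub_mulby (@ideal_exp_antimono _ a _ _ (leq_addr n k)).
  apply: (WL _ (f \o q) (leq_addl _ _)) => [x|]; first by rewrite /= q1 f1 !mul1r.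
  have [h h1] : exists h : {linear E (k + n) -> E' n}, mulby 1 h.
    by exists (f \o q) => x; rewrite /= q1 f1 !mul1r.
  apply/(triv_sub_comp g q1 f1 _) => [x|]; first by rewrite /= q1 f1 !mul1r.
  exact: triv_lift (syz_map_lift q) t.
move=> f1 t.
have [e e1] := sub_mulby (addp_sub_pow nk (leqnn n)).
have [be be1] := sub_mulby (@ideal_addpl _ (ideal_exp a k) (y ^+ n)).
have [al aly] := colon_mulby (ideal_exp a k) (y ^+ n).
have {}t := iffLR (triv_sub_comp g be1 e1 f1) t.
have [zeta zetaP] := Ext_exact_right (short_exact_colon aly be1) t.
have [q q1] := sub_mulby (@sub_colon (ideal_exp a k) (y ^+ n)).
have [l /lc_scale_eq0_large[N0 ltriv]] := tors (lc (zeta \o syz_map q i)).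
pose N := (N0 + k)%N; have kN : (k <= N)%N by exact: leq_addl.
have [p p1] := sub_mulby (@ideal_exp_antimono _ a _ _ kN).
have {}ltriv := ltriv N p (leq_addr _ _) p1.
(* The map R/(a^N : y^m') -> R/(a^k : y^n) is multiplication by y^(m' - n) = y^(m0 + l). It factors
   through R/a^N: y^m0 maps into R/a^N by stability of the colon ideals, and y^l kills the pullback
   of [zeta] there. *)
have [m0 m0P] := stab N; pose m' := (m0 + l + n)%N.
have nm' : (n <= m')%N by exact: leq_addl.
have [al' aly'] := colon_mulby (ideal_exp a N) (y ^+ m').
have [be' be1'] := sub_mulby (@ideal_addpl _ (ideal_exp a N) (y ^+ m')).
have [ka kay] := mulby_ex (pow_colon_sub (@ideal_exp_antimono _ a _ _ kN) nm').
have [c c1] := sub_mulby (addp_sub_addp kN nm').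
have tc : @triv R (free_resol _) i.+1 M (g \o syz_map e i.+1 \o syz_map c i.+1).
  apply: (zetaP _ _ _ al' be' ka p c (short_exact_colon aly' be1')) => [z|z|].
  - have [x ->] := quom_piE z; rewrite kay aly aly' p1 mul1r mulrA -exprD.
    by rewrite /m' addnC addnK.
  - by have [x ->] := quom_piE z; rewrite p1 be1 be1' c1.
  have [b bE] : exists b : {linear quom (ideal_colon (ideal_exp a N) (y ^+ m')) -> E N},
      mulby (y ^+ m0) b.
    apply: mulby_ex => x xc; rewrite -ideal_colonP.
    by apply: m0P xc; rewrite /m' -addnA leq_addr.
  have [s sE] : exists s : {linear E N -> quom (ideal_colon (ideal_exp a k) (y ^+ n))},
      mulby (y ^+ l) s.
    apply: mulby_ex => x xN; apply/ideal_mul/sub_colon.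
    exact: ideal_exp_antimono kN _ xN.
  apply/(triv_mulby_comp zeta bE sE); first by rewrite -exprD (addnC l) -[(m0 + l)%N](addnK n).
  apply: triv_lift (syz_map_lift b) _.
  have [r r1] : exists r : {linear E N -> quom (ideal_colon (ideal_exp a k) (y ^+ n))},
    mulby 1 r by exists (q \o p) => x; rewrite /= p1 q1 !mul1r.
  apply/(triv_mulby zeta sE r1).
  have rr : @triv R (free_resol (E N)) i M ((y ^+ l \*: zeta) \o syz_map q i \o syz_map p i).
    by apply: triv_ext ltriv => x.
  by have /(triv_sub_comp (y ^+ l \*: zeta) p1 q1 r1) := rr.
have [u u1] := sub_mulby (@ideal_exp_addp R a y N m').
have [v v1] : exists v : {linear E' (N + m') -> E' n}, mulby 1 v.
  by exists (e \o c \o u) => x; rewrite /= u1 c1 e1 !mul1r.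
apply/lc_eq0; exists (N + m')%N, v; split=> //.
have [w w1] : exists w : {linear quom (ideal_addp (ideal_exp a N) (y ^+ m')) -> E' n}, mulby 1 w.
  by exists (e \o c) => x; rewrite /= c1 e1 !mul1r.
apply/(triv_sub_comp g u1 w1 v1); apply: triv_lift (syz_map_lift u) _.
by apply/(triv_sub_comp g c1 e1 w1).
Qed.

(* The sequence [H^(i-1)_a(M)_y -> H^i_(a+y)(M) -> H^i_a(M) -> H^i_a(M)_y]
   when both ends vanish. *)
Lemma lc_addp_ann_sub i : power_torsion (H i) y ->
  ann_sub (H' i.+1) (H i.+1).
Proof.
move=> tors xi; have [n [g ->]] := lc_surj xi.
have [f f1] := sub_mulby (ideal_exp_mono (n := n) (@ideal_addpl _ a y)).
exists (lc (g \o syz_map f i.+1)) => r; split.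
  move=> /lc_scale_eq0_large[N0 t].
  have [u u1] := sub_mulby (@ideal_exp_antimono _ a' _ _ (leq_addl N0 n)).
  have [p p1] := sub_mulby (@ideal_exp_antimono _ a _ _ (leq_addl N0 n)).
  have [v v1] := sub_mulby (ideal_exp_mono (n := N0 + n) (@ideal_addpl _ a y)).
  have {}t := triv_lift (syz_map_lift v) (t _ u (leq_addr _ _) u1).
  apply/lc_scale_eq0; exists (N0 + n)%N, p; split=> //.
  by apply: triv_ext (triv_sub_square (g := r \*: g) v1 u1 p1 f1 t).
move=> /lc_scale_eq0[N [p [p1 t]]]; rewrite -lcZ.
have [h h1] : exists h : {linear E N -> E' n}, mulby 1 h.
  by exists (f \o p) => x; rewrite /= p1 f1 !mul1r.
by apply: (lc_addp_inj tors h1); apply/(triv_sub_comp (r \*: g) p1 f1 h1).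
Qed.

(** The surjectivity half. A class killed by a power of y becomes trivial along multiplication by
    y^m from R/(a^N : y^m) for large m, so by exactness in the middle it comes from R/(a^N + y^m R),
    hence from a power of a + Ry. *)
Lemma lc_addp_ann_sub_rev i : power_torsion (H i) y -> power_torsion (H i.+1) y ->
  ann_sub (H i.+1) (H' i.+1).
Proof.
move=> tors tors1 xi; have [n [g ->]] := lc_surj xi.
have [l /lc_scale_eq0_large[N0 ltriv]] := tors1 (lc g).
pose N := (N0 + n)%N.
have [p p1] := sub_mulby (@ideal_exp_antimono _ a _ _ (leq_addl N0 n)); rewrite -/N in p p1 *.
have {}ltriv := ltriv N p (leq_addr _ _) p1.
(* As for injectivity, y^m0 carries R/(a^N : y^m) into R/a^N, and y^l kills the class over R/a^N. *)
have [m0 m0P] := stab N; pose m := (m0 + l)%N.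
have [al aly] := colon_mulby (ideal_exp a N) (y ^+ m).
have [be be1] := sub_mulby (@ideal_addpl _ (ideal_exp a N) (y ^+ m)).
have [b bE] : exists b : {linear quom (ideal_colon (ideal_exp a N) (y ^+ m)) -> E N},
    mulby (y ^+ m0) b.
  by apply: mulby_ex => x xc; rewrite -ideal_colonP; apply: m0P xc; exact: leq_addr.
have [s sE] : exists s : {linear E N -> E n}, mulby (y ^+ l) s.
  apply: mulby_ex => x xN; apply: ideal_mul.
  exact: (ideal_exp_antimono (leq_addl N0 n) xN).
have [h hE] : exists h : {linear quom (ideal_colon (ideal_exp a N) (y ^+ m)) -> E n},
    mulby (y ^+ m) h.
  by exists (p \o al) => x; rewrite /= aly p1 mul1r.
have : @triv R (free_resol _) i.+1 M (g \o syz_map p i.+1 \o syz_map al i.+1).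
  apply/(triv_mulby_comp g aly p1 (h := h)); first by rewrite mul1r.
  apply/(triv_mulby_comp g bE sE (h := h)); first by rewrite -exprD addnC.
  by apply: triv_lift (syz_map_lift b) _; apply/(triv_mulby g sE p1).
move=> /(Ext_exact_middle (short_exact_colon aly be1))[eta etaP].
have [u u1] := sub_mulby (@ideal_exp_addp R a y N m).
exists (lc (eta \o syz_map u i.+1)) => r.
have E1 := @lc_triv_eq _ a i.+1 M N (g \o syz_map p i.+1) (eta \o syz_map be i.+1) etaP.
apply: (iff_trans (iff_sym (lc_sub_scale r g p1))); move: E1.
move: (lc (g \o syz_map p i.+1)) => z ->.
split=> /lc_scale_eq0_large[K0 t]; pose K := (K0 + (N + m))%N.
  (* This direction is injectivity, which uses torsion in degree i; the converse is restriction to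
     powers of a. *)
  have NK : (N <= K)%N by rewrite /K addnCA leq_addr.
  have [q q1] := sub_mulby (@ideal_exp_antimono _ a _ _ NK).
  have [w w1] : exists w : {linear E K -> E' (N + m)}, mulby 1 w.
    apply: sub_mulby => x /(ideal_exp_mono (@ideal_addpl _ a y)).
    exact: (@ideal_exp_antimono _ a' _ _ (leq_addl K0 (N + m))).
  rewrite -lcZ; apply: (lc_addp_inj tors w1).
  have {}t := t K q (leq_addr _ _) q1.
  by apply: triv_ext (triv_sub_square (g := r \*: eta) q1 be1 w1 u1 t).
have NK : (N <= K)%N by rewrite /K addnCA leq_addr.
have [q q1] := sub_mulby (@ideal_exp_antimono _ a _ _ NK).
have [w w1] := sub_mulby (@ideal_exp_antimono _ a' _ _ (leq_addl K0 (N + m))).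
have [v v1] := sub_mulby (ideal_exp_mono (n := K) (@ideal_addpl _ a y)).
have {}t := triv_lift (syz_map_lift v) (t K w (leq_addr _ _) w1).
apply/lc_scale_eq0; exists K, q; split=> //.
have [uw uw1] : exists uw : {linear E' K -> quom (ideal_addp (ideal_exp a N) (y ^+ m))}, mulby 1 uw.
  by exists (u \o w) => x; rewrite /= w1 u1 !mul1r.
have {}t : @triv R (free_resol (E K)) i.+1 M ((r \*: eta) \o syz_map uw i.+1 \o syz_map v i.+1).
  apply: (@triv_lift_uniq R (free_resol (E K)) (free_resol (quom (ideal_addp (ideal_exp a N) (y ^+ m))))
    _ _ i.+1 M (r \*: eta) (lift_comp (syz_map_lift v) (syz_map_lift uw))
    (lift_comp (syz_map_lift v) (lift_comp (syz_map_lift w) (syz_map_lift u))) _ t).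
  by move=> c; have [x ->] := quom_piE c; rewrite /= v1 uw1 w1 u1 !mul1r.
by apply: triv_ext (triv_sub_square (g := r \*: eta) v1 uw1 q1 be1 t).
Qed.

End AddOneElement.

(** * Noetherian modules, associated primes and Nakayama's lemma *)

Section Noetherian.
Variable R : comNzRingType.
Implicit Types (I J : ideal R) (V : lmodType R).

Definition noeth_mod V := forall N : submodClosed V, exists s : seq V, N =i gen_sub [set` s].

Lemma submodB V (N : submodClosed V) x y : x \in N -> y \in N -> x - y \in N.
Proof. by move=> xN yN; rewrite -scaleN1r rpredD ?rpredZ. Qed.

Lemma noeth_chain V (F : nat -> submodClosed V) : noeth_mod V ->
  (forall n, {subset F n <= F n.+1}) ->
  exists n0, forall n, (n0 <= n)%N -> {subset F n <= F n0}.
Proof.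
move=> nV inc; have mono m n : (m <= n)%N -> {subset F m <= F n}.
  elim: n => [|n IH]; first by rewrite leqn0 => /eqP ->.
  by rewrite leq_eqVlt => /orP[/eqP -> //|mn] x /(IH mn); exact: inc.
pose D (x : V) := exists n, x \in F n.
have DP : D 0 /\ forall a u v, D u -> D v -> D (a *: u + v).
  split; first by exists 0%N; exact: rpred0.
  move=> a u v [n un] [k vk]; exists (maxn n k).
  by rewrite rpredD ?rpredZ // ?(mono _ _ (leq_maxl n k) _ un) ?(mono _ _ (leq_maxr n k) _ vk).
have [s sE] := nV (psub DP).
have [n0 n0P] : exists n0, forall x, x \in s -> x \in F n0.
  have {sE} : forall x, x \in s -> D x.
    by move=> x xs; apply/psubP; rewrite sE; exact: mem_gen_sub.
  elim: s => [|x s IH] sD; first by exists 0%N.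
  have [n nP] := IH (fun y ys => sD y (@mem_behead _ (x :: s) y ys)).
  have [k kP] := sD x (mem_head x s); exists (maxn n k) => y.
  rewrite inE => /orP[/eqP ->|/nP]; first exact: mono (leq_maxr n k) _ kP.
  by apply: mono; exact: leq_maxl.
exists n0 => n _ x xn; have : x \in psub DP by apply/psubP; exists n.
by rewrite sE; apply: gen_sub_ind => y; exact: n0P.
Qed.

Lemma noeth_max V (P : submodClosed V -> Prop) (N0 : submodClosed V) : noeth_mod V -> P N0 ->
  exists N, [/\ P N, {subset N0 <= N} & forall N', P N' -> {subset N <= N'} -> {subset N' <= N}].
Proof.
move=> nV PN0; apply: contrapT => no.
have step (N : {N | P N /\ {subset N0 <= N}}) : exists N' : {N | P N /\ {subset N0 <= N}},
    {subset sval N <= sval N'} /\ ~ {subset sval N' <= sval N}.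
  case: N => N [PN N0N] /=; apply: contrapT => no'; apply: no; exists N; split=> // N' PN' NN'.
  apply: contrapT => nN'; apply: no'.
  have N0N' : {subset N0 <= N'} by move=> x /N0N /NN'.
  by exists (exist _ N' (conj PN' N0N')).
have [F FP] := choice step.
have N0' : P N0 /\ {subset N0 <= N0} by split=> // x.
pose G n := iter n F (exist (fun N => P N /\ {subset N0 <= N}) N0 N0').
have [n0 n0P] := @noeth_chain V (fun n => sval (G n)) nV (fun n => (FP (G n)).1).
have [_ no0] := FP (G n0); apply: no0; exact: n0P n0.+1 (leqnSn n0).
Qed.

Lemma gen_sub_nil V (x : V) : x \in gen_sub [set` [::]] -> x = 0.
Proof.
move=> x0; suff : x \in zero_sub V by rewrite unfold_in => /eqP.
by apply: gen_sub_ind x0 => s.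
Qed.

Lemma gen_sub_consP V (e : V) s (x : V) : x \in gen_sub [set` e :: s] <->
  exists r w, w \in gen_sub [set` s] /\ x = r *: e + w.
Proof.
split.
  pose D (x : V) := exists r w, w \in gen_sub [set` s] /\ x = r *: e + w.
  have DP : D 0 /\ forall a u v, D u -> D v -> D (a *: u + v).
    split; first by exists 0, 0; rewrite rpred0 scale0r addr0.
    move=> a u v [r [w [ws ->]]] [r' [w' [ws' ->]]]; exists (a * r + r'), (a *: w + w').
    by rewrite rpredD ?rpredZ // scalerDr scalerA scalerDl addrACA.
  move=> xg; apply/(psubP DP); apply: gen_sub_ind xg => y.
  rewrite /= inE => /orP[/eqP ->|ys]; apply/psubP.
    by exists 1, 0; rewrite rpred0 scale1r addr0.
  by exists 0, y; rewrite scale0r add0r; split=> //; exact: mem_gen_sub.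
move=> [r [w [ws ->]]]; rewrite rpredD ?rpredZ //.
  by apply: mem_gen_sub; rewrite /= mem_head.
by apply: gen_sub_ind ws => y /= ys; apply: mem_gen_sub; rewrite /= inE ys orbT.
Qed.

Lemma fin_gen_noeth V : noetherian_ring R -> fin_gen V -> noeth_mod V.
Proof.
move=> nR [s sV] N; have {sV} : {subset N <= gen_sub [set` s]} by [].
elim: s N => [|e s IH] N Ns.
  exists [::] => x; apply/idP/idP => [/Ns //|/gen_sub_nil ->]; exact: rpred0.
(* The ideal of coefficients of [e] in elements of N, modulo the span of [s]. Lifts of its
   generators, together with generators of the part of N inside that span, generate N. *)
pose D (r : R^o) := exists w, w \in gen_sub [set` s] /\ r *: e + w \in N.
have DP : D 0 /\ forall (a : R) (u v : R^o), D u -> D v -> D (a *: u + v).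
  split; first by exists 0; rewrite scale0r addr0 !rpred0.
  move=> a u v [w [ws uw]] [w' [ws' uw']]; exists (a *: w + w').
  rewrite rpredD ?rpredZ //; split=> //; rewrite scalerDl -[a *: u]/(a * u).
  by rewrite -scalerA addrACA -scalerDr rpredD ?rpredZ.
have [rs rsE] := nR (psub DP).
have rsD r : r \in rs -> D r by move=> rrs; apply/psubP; rewrite rsE; exact: mem_gen_sub.
have CP : (0 \in N /\ 0 \in gen_sub [set` s]) /\ forall a (u v : V),
    (u \in N /\ u \in gen_sub [set` s]) -> (v \in N /\ v \in gen_sub [set` s]) ->
    (a *: u + v \in N /\ a *: u + v \in gen_sub [set` s]).
  by split=> [|a u v [uN us] [vN vs]]; rewrite ?rpred0 ?rpredD ?rpredZ.
have [|t tE] := IH (psub CP); first by move=> x /(psubP CP)[].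
have [ns [nsN nsrs]] : exists ns : seq V, (forall x, x \in ns -> x \in N) /\
    forall r, r \in gen_sub [set` rs] -> exists w, w \in gen_sub [set` s] /\
      r *: e + w \in gen_sub [set` ns].
  elim: rs rsD {rsE} => [|r rs IHr] rsD.
    exists [::]; split=> // r /gen_sub_nil ->; exists 0; by rewrite scale0r addr0 !rpred0.
  have [ns [nsN nsP]] := IHr (fun y ys => rsD y (@mem_behead _ (r :: rs) y ys)).
  have [w [ws rw]] := rsD r (mem_head r rs); exists (r *: e + w :: ns); split.
    by move=> x; rewrite inE => /orP[/eqP ->|/nsN].
  move=> _ /gen_sub_consP[c [r' [/nsP[w' [ws' rw']] ->]]]; exists (c *: w + w').
  split; first by rewrite rpredD ?rpredZ.
  apply/gen_sub_consP; exists c, (r' *: e + w'); split=> //.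
  by rewrite scalerDl -[c *: r]/(c * r) -scalerA scalerDr addrACA.
have catl (u v : seq V) x : x \in gen_sub [set` u] -> x \in gen_sub [set` u ++ v].
  by apply: gen_sub_ind => y yu; apply: mem_gen_sub; rewrite /= mem_cat yu.
have catr (u v : seq V) x : x \in gen_sub [set` v] -> x \in gen_sub [set` u ++ v].
  by apply: gen_sub_ind => y yu; apply: mem_gen_sub; rewrite /= mem_cat yu orbT.
exists (ns ++ t) => x; apply/idP/idP; last first.
  apply: gen_sub_ind => y; rewrite /= mem_cat => /orP[/nsN //|yt].
  have /(psubP CP)[] // : y \in psub CP by rewrite tE; exact: mem_gen_sub.
move=> xN; have /gen_sub_consP[r [w [ws xE]]] := Ns x xN.
have : r \in psub DP by apply/(psubP DP); exists w; rewrite -xE.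
rewrite rsE => /nsrs[w' [ws' rw']].
have d : x - (r *: e + w') \in psub CP.
  apply/(psubP CP); split; last by rewrite xE opprD addrACA subrr add0r submodB.
  by rewrite submodB //; apply: gen_sub_ind rw'.
rewrite -(subrK (r *: e + w') x) rpredD //; last exact: catl.
by apply: catr; rewrite -tE.
Qed.

End Noetherian.

(** * Prime ideals and associated primes *)

Section Primes.
Variable R : comNzRingType.
Implicit Types (I J : ideal R) (V : lmodType R) (p q : pred R).

Section PrimeFacts.
Variable p : pred R.
Hypothesis pp : prime_ideal p.

Lemma prime_0 : 0 \in p. Proof. by case: pp => -[]. Qed.
Lemma prime_1 : 1 \notin p. Proof. by case: pp => -[]. Qed.
Lemma prime_lin a u v : u \in p -> v \in p -> a * u + v \in p.
Proof. by case: pp => -[_ _ h] _ up vp; apply: h. Qed.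
Lemma prime_mull a u : u \in p -> a * u \in p.
Proof. by move=> up; rewrite -[a * u]addr0 prime_lin // prime_0. Qed.
Lemma prime_mulr a u : u \in p -> u * a \in p.
Proof. by rewrite mulrC; exact: prime_mull. Qed.
Lemma prime_add u v : u \in p -> v \in p -> u + v \in p.
Proof. by move=> up vp; rewrite -[u]mul1r prime_lin. Qed.
Lemma prime_opp u : u \in p -> - u \in p.
Proof. by rewrite -mulN1r; exact: prime_mull. Qed.
Lemma prime_mul u v : u * v \in p -> u \in p \/ v \in p.
Proof. by case: pp => _ h /h /orP. Qed.
Lemma prime_notin_mul u v : u \notin p -> v \notin p -> u * v \notin p.
Proof. by move=> /negP up /negP vp; apply/negP => /prime_mul[]. Qed.
Lemma prime_exp u k : u ^+ k \in p -> u \in p.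
Proof.
elim: k => [|k IH]; first by rewrite expr0 (negPf prime_1).
by rewrite exprS => /prime_mul[//|/IH].
Qed.

Fact prime_submod : 0 \in p /\ forall (a : R) (u v : R^o), u \in p -> v \in p -> a *: u + v \in p.
Proof. by split; [exact: prime_0|move=> a u v; exact: prime_lin]. Qed.
Definition prime_id : ideal R := @psub R R^o (fun x => x \in p) prime_submod.
Lemma prime_idE x : (x \in prime_id) = (x \in p).
Proof. by apply/idP/idP => [/(psubP prime_submod)|h] //; apply/(psubP prime_submod). Qed.

End PrimeFacts.

Section AnnElement.
Variables (V : lmodType R) (v : V).
Fact ann_el_closed : (0 : R) *: v = 0 /\ forall (a : R) (u w : R^o),
  (u : R) *: v = 0 -> (w : R) *: v = 0 -> (a *: u + w : R^o) *: v = 0.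
Proof.
split; first by rewrite scale0r.
by move=> a u w u0 w0; rewrite scalerDl -[a *: u]/(a * u) -scalerA u0 w0 scaler0 addr0.
Qed.
Definition ann_el : ideal R := @psub R R^o (fun r : R => r *: v = 0) ann_el_closed.
Lemma ann_elP r : r \in ann_el <-> r *: v = 0.
Proof. by split=> [/(psubP ann_el_closed)|h] //; apply/(psubP ann_el_closed). Qed.
End AnnElement.

Lemma AssP V p : Ass V p <-> prime_ideal p /\ exists x : V, forall r, r \in p <-> r *: x = 0.
Proof.
split=> -[pp [x xp]]; split=> //; exists x => r; first by rewrite xp inE; split=> /eqP.
by rewrite inE; apply/idP/eqP => /xp.
Qed.

Lemma ann_sub_Ass (X Y : lmodType R) : (forall x : X, exists y : Y, forall r, r *: x = 0 <-> r *: y = 0) ->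
  forall p, @Ass R X p -> @Ass R Y p.
Proof.
move=> XY p /AssP[pp [x xp]]; apply/AssP; split=> //.
by have [y yx] := XY x; exists y => r; rewrite -yx.
Qed.

Hypothesis nR : noetherian_ring R.

Lemma noeth_regular : noeth_mod (R^o : lmodType R).
Proof. exact: nR. Qed.

(* Among the annihilators contained in [p] of nonzero multiples of [v], a
   maximal one is prime. *)
Lemma Ass_between V (v : V) p : prime_ideal p -> (forall r, r *: v = 0 -> r \in p) ->
  exists q, [/\ Ass V q, {subset q <= p} & forall r, r *: v = 0 -> r \in q].
Proof.
move=> pp vp; pose P (I : ideal R) := exists w : V, (forall r, r \in I <-> r *: w = 0) /\
  {subset I <= prime_id pp}.
have [|I [[w [Iw Ip]] vI Imax]] := @noeth_max R _ P (ann_el v) noeth_regular.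
  by exists v; split=> [r|r /ann_elP/vp]; [exact: ann_elP|rewrite prime_idE].
have {}Imax u : (forall r, r * u \in I -> r \in p) -> forall r, r * u \in I -> r \in I.
  move=> up r ru; apply: (Imax (ann_el (u *: w))); last first.
  - by apply/ann_elP; rewrite scalerA; apply/Iw.
  - by move=> s /Iw sw; apply/ann_elP; rewrite scalerA mulrC -scalerA sw scaler0.
  exists (u *: w); split=> [s|s /ann_elP]; first exact: ann_elP.
  by rewrite scalerA prime_idE => /Iw/up.
have outp u : u \notin p -> forall r, r * u \in I -> r \in I.
  move=> up; apply: Imax => r /Ip; rewrite prime_idE => /(prime_mul pp)[//|].
  by rewrite (negPf up).
exists (fun x => x \in I); split; last by move=> r rv; apply: vI; apply/ann_elP.
  apply/AssP; split; last by exists w => r; exact: Iw.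
  split; first split.
  - exact: ideal0.
  - by apply/negP => /Ip; rewrite prime_idE (negPf (prime_1 pp)).
  - by move=> a u x; exact: (fun uI xI => idealD (ideal_mul a uI) xI).
  move=> r s rs; have [sI|/negP sI] := pselect (s \in I); first by apply/orP; right.
  (* A [t] outside p with t * s in I would put s itself into I by [outp]. *)
  apply/orP; left; apply: (Imax s) rs => t ts; apply: contrapT => /negP tp.
  by move/negP: sI; apply; apply: (outp t tp); rewrite mulrC.
by move=> r /Ip; rewrite prime_idE.
Qed.

End Primes.

(** * Associated primes and prime avoidance over a Noetherian local ring *)

Section LocalRing.
Variables (R : comNzRingType) (m : ideal R).
Hypotheses (nR : noetherian_ring R) (lR : local_ring m).
Implicit Types (I J : ideal R) (V : lmodType R) (p q : pred R).

Lemma proper_sub_max I : 1 \notin I -> {subset I <= m}.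
Proof.
move=> I1; have [J [J1 IJ Jmax]] := @noeth_max R _ (fun J => 1 \notin J) I (noeth_regular nR) I1.
have Jm : maximal_ideal J.
  split=> // K JK K1 x; apply/idP/idP => [|/JK //]; exact: Jmax.
by move=> x /IJ; rewrite (lR.2 J Jm).
Qed.

Lemma one_notin_max : 1 \notin m. Proof. by case: lR => -[]. Qed.

Lemma notin_max_inv u : u \notin m -> exists v, v * u = 1.
Proof.
move=> um; have [|/negP/proper_sub_max h] := pselect (1 \in ideal_addp (zero_sub R^o) u).
  move=> /ideal_addpP[z [v [z0 e]]]; exists v.
  by move: z0 e; rewrite unfold_in => /eqP ->; rewrite add0r.
by have := h _ (ideal_addpr _ u 1); rewrite mul1r (negPf um).
Qed.

Lemma prime_max : prime_ideal (fun x => x \in m).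
Proof.
split; first split.
- exact: ideal0.
- exact: one_notin_max.
- by move=> a u v um vm; exact: (idealD (ideal_mul a um) vm).
move=> u v uv; have [um|/negP um] := pselect (u \in m); first by apply/orP; left.
apply/orP; right; have [w wu] := notin_max_inv um.
by rewrite -[v]mul1r -wu -mulrA; exact: ideal_mul.
Qed.

Lemma Ass_above V (v : V) : v <> 0 -> exists q, Ass V q /\ forall r, r *: v = 0 -> r \in q.
Proof.
move=> v0; have [|q [qV _ qv]] := Ass_between nR (v := v) prime_max; last by exists q.
move=> r rv; apply: contrapT => /negP /notin_max_inv[s sr].
by apply: v0; rewrite -[v]scale1r -sr -scalerA rv scaler0.
Qed.

Lemma zerodivisor_Ass V r : ~ nonzerodivisor V r -> exists q, Ass V q /\ r \in q.
Proof.
move=> nz; have [v [rv v0]] : exists v : V, r *: v = 0 /\ v <> 0.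
  by apply: contrapT => no; apply: nz => v rv; apply: contrapT => v0; apply: no; exists v.
by have [q [qV qr]] := Ass_above v0; exists q; split=> //; exact: qr.
Qed.

(** In place of a prime filtration, a submodule N maximal with finitely many associated primes is
    taken. If N were proper, adjoining a v whose class modulo N has prime annihilator q would add at
    most the prime q. *)
Lemma Ass_finite V : noeth_mod V -> finite_set (Ass V).
Proof.
move=> nV; pose A (N : submodClosed V) : set (pred R) := [set p | prime_ideal p /\
  exists x, x \in N /\ forall r, r \in p <-> r *: x = 0].
have [|N [fN _ Nmax]] := @noeth_max R V (fun N => finite_set (A N)) (zero_sub V) nV.
  rewrite (_ : A _ = set0) //; apply/seteqP; split=> // p [pp [x [x0 xp]]].
  have /negP := prime_1 pp; apply; apply/xp; move: x0; rewrite unfold_in => /eqP ->.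
  exact: scaler0.
have [NT|] := pselect (forall x, x \in N).
  by apply: sub_finite_set fN => p /AssP[pp [x xp]]; split=> //; exists x.
move=> /existsNP[x xN]; exfalso.
have [|q [/AssP[qp [y yq]] _]] := @Ass_above (quom N) (quom_pi N x).
  by move=> /quom_pi_eq0.
have [v ve] := quom_piE y; rewrite {y}ve in yq.
have {}yq r : r \in q <-> r *: v \in N by rewrite yq -linearZ quom_pi_eq0.
pose D z := exists n r, n \in N /\ z = n + r *: v.
have DP : D 0 /\ forall a u w, D u -> D w -> D (a *: u + w).
  split; first by exists 0, 0; rewrite rpred0 scale0r addr0.
  move=> a u w [n [r [nN ->]]] [n' [r' [nN' ->]]]; exists (a *: n + n'), (a * r + r').
  by rewrite rpredD ?rpredZ // scalerDr scalerDl scalerA addrACA.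
have vN : v \notin N by apply/negP => vN; move/negP: (prime_1 qp); apply; apply/yq; rewrite scale1r.
move/negP: vN; apply; apply: (Nmax (psub DP)).
- apply: sub_finite_set (_ : finite_set (A N `|` [set q])); last first.
    by rewrite finite_setU; split=> //; exact: finite_set1.
  move=> p [pp [w [/psubP[n [r [nN wE]]] wp]]].
  (* Either a multiple of w by an element outside p lies in N, and it still has annihilator p, or
     the annihilator of w modulo N lies in p, which forces p = q. *)
  have [[s [sN sp]]|no] := pselect (exists s, s *: w \in N /\ s \notin p).
    left; split=> //; exists (s *: w); split=> // t; rewrite scalerA; split=> [tp|/wp].
      by apply/wp; rewrite mulrC; exact: prime_mull.
    by move=> /(prime_mul pp)[//|]; rewrite (negPf sp).
  right; have {}no s : s *: w \in N -> s \in p.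
    by move=> sN; apply: contrapT => /negP sp; apply: no; exists s.
  have rq : r \notin q.
    apply/negP => /yq rvN; move/negP: (prime_1 pp); apply; apply: no.
    by rewrite scale1r wE rpredD.
  apply/funext => t; apply/idP/idP => [/wp tw|tq].
    have : t * r \in q.
      apply/yq; rewrite -scalerA -[r *: v](addKr n) -wE scalerDr tw addr0 scalerN.
      by rewrite -scaleN1r !rpredZ.
    by move=> /(prime_mul qp)[//|]; rewrite (negPf rq).
  apply: no; rewrite wE scalerDr; apply: rpredD; first exact: rpredZ.
  by rewrite scalerA mulrC -scalerA; apply: rpredZ; apply/yq.
- by move=> n nN; apply/psubP; exists n, 0; rewrite scale0r addr0.
- by apply/psubP; exists 0, 1; rewrite rpred0 scale1r add0r.
Qed.

(** An ideal maximal among those above [I] that contain no power of [r] is prime. *)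
Lemma radical_mem I r : (forall p, prime_ideal p -> {subset I <= p} -> r \in p) ->
  exists k, r ^+ k \in I.
Proof.
move=> rI; apply: contrapT => no.
have [|J [Jr IJ Jmax]] := @noeth_max R _ (fun J => forall k, r ^+ k \notin J) I (noeth_regular nR).
  by move=> k; apply/negP => rk; apply: no; exists k.
have J1 : 1 \notin J by exact: Jr 0%N.
have [u [v [uv [uJ vJ]]]] : exists u v, u * v \in J /\ u \notin J /\ v \notin J.
  apply: contrapT => npr; suff : r \in (fun x => x \in J).
    by move/negP: (Jr 1%N) => h; exact: h.
  apply: rI => //; split; first split; [exact: ideal0|exact: J1| |].
    by move=> a u v uJ vJ; exact: (idealD (ideal_mul a uJ) vJ).
  move=> u v uv; apply/orP; apply: contrapT => /not_orP[/negP uJ /negP vJ].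
  by apply: npr; exists u, v.
have big w : w \notin J -> exists k c, r ^+ k - c * w \in J.
  move=> wJ; apply: contrapT => nk; move/negP: wJ; apply; apply: (Jmax (ideal_addp J w)).
  - move=> k; apply/negP => /ideal_addpP[x [c [xJ e]]]; apply: nk; exists k, c.
    by rewrite e addrK.
  - exact: ideal_addpl.
  - by have := ideal_addpr J w 1; rewrite mul1r.
have [k [c kc]] := big u uJ; have [l [d ld]] := big v vJ.
move/negP: (Jr (k + l)%N); apply; rewrite exprD.
rewrite -[r ^+ k](subrK (c * u)) -[r ^+ l](subrK (d * v)) mulrDl.
apply: idealD; first by rewrite mulrC; exact: ideal_mul.
rewrite mulrDr; apply: idealD; first exact: ideal_mul.
by rewrite mulrACA; exact: ideal_mul.
Qed.

Lemma prime_avoidance I (ps : seq (pred R)) : (forall p, p \in ps -> prime_ideal p) ->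
  (forall p, p \in ps -> exists2 x, x \in I & x \notin p) ->
  exists2 y, y \in I & forall p, p \in ps -> y \notin p.
Proof.
have [n] := ubnP (size ps); elim: n ps => // n IH [|p ps] psn pps Ips.
  by exists 0; first exact: ideal0.
have [[q [qps qp]]|no] := pselect (exists q, q \in ps /\ {subset q <= p}).
  have [|q' q'ps|q' q'ps|y yI yp] := IH (p :: rem q ps).
  - by rewrite /= size_rem // prednK //; case: (ps) qps.
  - by apply: pps; move: q'ps; rewrite !inE => /orP[->//|/mem_rem ->]; rewrite orbT.
  - by apply: Ips; move: q'ps; rewrite !inE => /orP[->//|/mem_rem ->]; rewrite orbT.
  have yq : y \notin q by apply: contra (yp p (mem_head _ _)); exact: qp.
  exists y => // q' q'p; have [->//|qq] := eqVneq q' q.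
  apply: yp; move: q'p; rewrite !inE => /orP[->//|q'p].
  by move: q'p; rewrite (perm_mem (perm_to_rem qps)) inE (negPf qq) /= => ->; rewrite orbT.
have [|q' q'ps|q' q'ps|y yI yp] := IH ps => //.
- by apply: pps; rewrite inE q'ps orbT.
- by apply: Ips; rewrite inE q'ps orbT.
have pp := pps p (mem_head _ _).
have [yp'|ynp] := boolP (y \in p); last first.
  by exists y => // q; rewrite inE => /orP[/eqP ->//|/yp].
have [w [wp wps]] : exists w, w \notin p /\ forall q, q \in ps -> w \in q.
  have : forall q, q \in ps -> prime_ideal q by move=> q qps; apply: pps; rewrite inE qps orbT.
  elim: (ps) no => [|q qs IHq] no pqs; first by exists 1; split=> //; exact: prime_1.
  have [|q' h|w [wp wqs]] := IHq; first by move=> [q' [h h']]; apply: no; exists q'; rewrite inE h orbT.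
    by apply: pqs; rewrite inE h orbT.
  have [z [zq zp]] : exists z, z \in q /\ z \notin p.
    apply: contrapT => nz; apply: no; exists q; split; first exact: mem_head.
    by move=> z zq; apply: contrapT => /negP zp; apply: nz; exists z.
  exists (w * z); split; first exact: prime_notin_mul.
  have pq := pqs q (mem_head _ _).
  move=> q'; rewrite inE => /orP[/eqP ->|h]; first exact: prime_mull.
  by apply: prime_mulr (wqs _ h); apply: pqs; rewrite inE h orbT.
have [u uI up] := Ips p (mem_head _ _).
exists (y + u * w); first by apply: idealD => //; rewrite mulrC; exact: ideal_mul.
move=> q; rewrite inE => /orP[/eqP ->|qps].
  apply/negP => h; move/negP: (prime_notin_mul pp up wp); apply.
  by rewrite -[u * w](addKr y) prime_add ?prime_opp.
have qp : prime_ideal q by apply: pps; rewrite inE qps orbT.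
apply/negP => h; move/negP: (yp q qps); apply.
by rewrite -[y](addrK (u * w)) prime_add ?prime_opp ?prime_mull ?wps.
Qed.

End LocalRing.

(** * Nakayama's lemma and supports *)

Section Nakayama.
Variable R : comNzRingType.
Implicit Types (I J : ideal R) (V M : lmodType R) (p q : pred R).

Lemma ideal_act_consP V I (e : V) (s : seq V) (x : V) : x \in ideal_act I (gen_sub [set` e :: s]) ->
  exists r w, [/\ r \in I, w \in ideal_act I (gen_sub [set` s]) & x = r *: e + w].
Proof.
pose D (x : V) := exists r w, [/\ r \in I, w \in ideal_act I (gen_sub [set` s]) & x = r *: e + w].
have DP : D 0 /\ forall a u v, D u -> D v -> D (a *: u + v).
  split; first by exists 0, 0; rewrite ideal0 rpred0 scale0r addr0.
  move=> a u v [r [w [rI wI ->]]] [r' [w' [rI' wI' ->]]]; exists (a * r + r'), (a *: w + w').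
  split; last by rewrite scalerDr scalerA scalerDl addrACA.
    by apply: idealD => //; exact: ideal_mul.
  by apply: rpredD => //; exact: rpredZ.
move=> xg; apply/(psubP DP); apply: gen_sub_ind xg => _ [r [y [rI /gen_sub_consP[c [w [ws ->]]] ->]]].
apply/psubP; exists (c * r), (r *: w); split.
- exact: ideal_mul.
- by apply: mem_gen_sub; exists r, w.
- by rewrite scalerDr scalerA mulrC.
Qed.

(* Nakayama's lemma where the elements outside [p] play the role of units. *)
Lemma nakayama_prime V p I (W : submodClosed V) (s : seq V) (t : R) : prime_ideal p ->
  (forall r, r \in I -> r \in p) -> t \notin p ->
  (forall e, e \in s -> exists2 w, w \in W & t *: e - w \in ideal_act I (gen_sub [set` s])) ->
  exists2 u, u \notin p & forall e, e \in s -> u *: e \in W.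
Proof.
move=> pp Ip; elim: s t => [|e0 s IH] t tp st; first by exists 1; first exact: prime_1.
have [w0 w0W /ideal_act_consP[r [x0 [rI x0I e0E]]]] := st e0 (mem_head _ _).
have {}e0E : (t - r) *: e0 = w0 + x0.
  by rewrite scalerBl -[t *: e0](subrK w0) e0E addrAC [r *: e0 + _]addrC addrK addrC.
have up : t - r \notin p.
  apply/negP => h; move/negP: tp; apply; rewrite -[t](subrK r).
  by apply: prime_add => //; exact: Ip.
(* Multiplying the remaining relations by t - r, which is outside p, eliminates [e0] from them;
   their new leading coefficient is (t - r) * t. *)
have [|e es|u uq us] := IH ((t - r) * t).
- exact: prime_notin_mul.
- have [|w wW /ideal_act_consP[r' [x [rI' xI eE]]]] := st e; first by rewrite inE es orbT.
  exists ((t - r) *: w + r' *: w0); first by rewrite rpredD ?rpredZ.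
  have -> : ((t - r) * t) *: e - ((t - r) *: w + r' *: w0) = r' *: x0 + (t - r) *: x.
    rewrite -scalerA opprD addrA -scalerBr eE scalerDr scalerA mulrC -scalerA e0E scalerDr.
    by rewrite -[r' *: w0 + _ + _]addrA [r' *: w0 + _]addrC addrK.
  by rewrite rpredD ?rpredZ.
have x0W : u *: x0 \in W.
  have uP : u *: 0 \in W /\ forall a x y, u *: x \in W -> u *: y \in W -> u *: (a *: x + y) \in W.
    split; first by rewrite scaler0 rpred0.
    by move=> a x y ux uy; rewrite scalerDr scalerA mulrC -scalerA; apply: rpredD => //; exact: rpredZ.
  have : x0 \in @psub R V (fun x => u *: x \in W) uP.
    apply: gen_sub_ind x0I => _ [c [y [cI ys ->]]]; apply/psubP.
    rewrite scalerA mulrC -scalerA rpredZ //.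
    have : y \in @psub R V (fun x => u *: x \in W) uP by apply: gen_sub_ind ys => z zs; apply/psubP; exact: us.
    by move/psubP.
  by move/psubP.
exists (u * (t - r)); first exact: prime_notin_mul.
move=> e; rewrite inE => /orP[/eqP ->|es].
  by rewrite -scalerA e0E scalerDr rpredD // rpredZ.
by rewrite mulrC -scalerA rpredZ // us.
Qed.

Lemma fin_gen_quom V (N : submodClosed V) : fin_gen V -> fin_gen (quom N).
Proof.
move=> [s sV]; exists (map (quom_pi N) s) => y; have [x ->] := quom_piE y.
have : x \in preim_sub (quom_pi N) (gen_sub [set` map (quom_pi N) s]).
  apply: gen_sub_ind (sV x) => z zs; rewrite unfold_in; apply: mem_gen_sub => /=.
  exact: map_f.
by rewrite unfold_in.
Qed.

(** Otherwise each generator is killed by some element outside p, and the product of these elements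
    annihilates V. *)
Lemma fin_gen_support V p : fin_gen V -> prime_ideal p ->
  (forall r, (forall x : V, r *: x = 0) -> r \in p) ->
  exists v : V, forall r, r *: v = 0 -> r \in p.
Proof.
move=> [s sV] pp Vp; apply: contrapT => no.
have {}no (v : V) : exists r, r \notin p /\ r *: v = 0.
  apply: contrapT => nv; apply: no; exists v => r rv; apply: contrapT => /negP rp.
  by apply: nv; exists r.
have [r [rp rs]] : exists r, r \notin p /\ forall e, e \in s -> r *: e = 0.
  elim: (s) => [|e es [r [rp res]]]; first by exists 1; split=> //; exact: prime_1.
  have [c [cp ce]] := no e; exists (r * c); split; first exact: prime_notin_mul.
  move=> e'; rewrite inE => /orP[/eqP ->|/res h]; first by rewrite -scalerA ce scaler0.
  by rewrite mulrC -scalerA h scaler0.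
move/negP: rp; apply; apply: Vp => x.
have lr : linear ( *:%R r : V -> V) by move=> a u v; rewrite scalerDr !scalerA mulrC.
have : x \in ker_sub (mklin lr).
  by apply: gen_sub_ind (sV x) => e /= es; rewrite unfold_in /= rs.
by rewrite unfold_in => /eqP.
Qed.

End Nakayama.

(** * Quotients by sequences *)

Section SequenceAction.
Variables (R : comNzRingType) (M : lmodType R).
Implicit Types (I : ideal R) (s : seq R) (p q : pred R).

Lemma seq_act_nil (x : M) : x \in seq_act M [::] -> x = 0.
Proof.
move=> x0; suff : x \in zero_sub M by rewrite unfold_in => /eqP.
by apply: gen_sub_ind x0 => z [r]; rewrite in_nil.
Qed.

Lemma seq_act_scale s r (x : M) : r \in s -> r *: x \in seq_act M s.
Proof. by move=> rs; apply: mem_gen_sub; exists r => //; exists x. Qed.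

Lemma seq_act_rconsP s r (x : M) : x \in seq_act M (rcons s r) <->
  exists w y, w \in seq_act M s /\ x = w + r *: y.
Proof.
split.
  pose D (x : M) := exists w y, w \in seq_act M s /\ x = w + r *: y.
  have DP : D 0 /\ forall a u v, D u -> D v -> D (a *: u + v).
    split; first by exists 0, 0; rewrite rpred0 scaler0 addr0.
    move=> a u v [w [y [ws ->]]] [w' [y' [ws' ->]]]; exists (a *: w + w'), (a *: y + y').
    by rewrite rpredD ?rpredZ // !scalerDr !scalerA (mulrC r) addrACA.
  move=> xg; apply/(psubP DP); apply: gen_sub_ind xg => _ [c cs [y ->]]; apply/psubP.
  move: cs; rewrite mem_rcons inE => /orP[/eqP ->|cs].
    by exists 0, y; rewrite rpred0 add0r.
  by exists (c *: y), 0; rewrite scaler0 addr0 seq_act_scale.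
move=> [w [y [ws ->]]]; rewrite rpredD //; last by apply: seq_act_scale; rewrite mem_rcons mem_head.
apply: gen_sub_ind ws => _ [c cs [z ->]]; apply: seq_act_scale.
by rewrite mem_rcons inE cs orbT.
Qed.

(** Regularity without sM <> M; for M nonzero and s inside m, [seq_act_proper] supplies that
    condition. *)
Definition weakly_regular s := forall i, (i < size s)%N ->
  nonzerodivisor (quom (seq_act M (take i s))) (nth 0 s i).

Lemma weakly_regular_rcons s r : weakly_regular (rcons s r) <->
  weakly_regular s /\ nonzerodivisor (quom (seq_act M s)) r.
Proof.
rewrite /weakly_regular size_rcons; split=> [h|[h hr] i].
  split=> [i si|].
    have := h i (ltnW si); rewrite nth_rcons si -cats1 take_cat si; exact.
  have := h (size s) (ltnSn _); rewrite nth_rcons ltnn eqxx -cats1 take_cat ltnn subnn take0 cats0.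
  exact.
rewrite ltnS leq_eqVlt => /orP[/eqP ->|si].
  by rewrite nth_rcons ltnn eqxx -cats1 take_cat ltnn subnn take0 cats0.
by rewrite nth_rcons si -cats1 take_cat si; exact: h.
Qed.

Lemma nonzerodivisor_quom (N : submodClosed M) r : nonzerodivisor (quom N) r <->
  forall x, r *: x \in N -> x \in N.
Proof.
split=> h x; first by move=> rx; apply/quom_pi_eq0; apply: h; rewrite -linearZ; apply/quom_pi_eq0.
have [y ->] := quom_piE x; rewrite -linearZ => /quom_pi_eq0 /h yN; exact/quom_pi_eq0.
Qed.

Lemma Ass_quom_seq_act s p : Ass (quom (seq_act M s)) p ->
  (forall r, r \in s -> r \in p) /\ {subset annihilator M <= p}.
Proof.
move=> /AssP[pp [x xp]]; have [y yE] := quom_piE x; rewrite {x}yE in xp.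
split=> r rs; apply/xp; rewrite -linearZ; apply/quom_pi_eq0; first exact: seq_act_scale.
by move/asboolP: rs => ->; exact: rpred0.
Qed.

Hypothesis fgM : fin_gen M.

(** If [r] were outside p, then r M inside sM would, by Nakayama at p, give an annihilator of M
    outside p. *)
Lemma seq_act_support p s r : prime_ideal p -> {subset annihilator M <= p} ->
  (forall c, c \in s -> c \in p) -> (forall x, r *: x \in seq_act M s) -> r \in p.
Proof.
move=> pp Mp sp rM; apply: contrapT => /negP rp; have [gs gsM] := fgM.
have [|e _|u up us] := nakayama_prime (V := M) (I := prime_id pp) (W := zero_sub M) (s := gs) pp _ rp.
- by move=> c; rewrite prime_idE.
- exists 0; first exact: rpred0.
  rewrite subr0; apply: gen_sub_ind (rM e) => _ [c cs [z ->]].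
  by apply: mem_gen_sub; exists c, z; rewrite prime_idE sp // gsM.
move/negP: up; apply; apply: Mp; apply/asboolP => x.
have lu : linear ( *:%R u : M -> M) by move=> a v w; rewrite scalerDr !scalerA mulrC.
have : x \in ker_sub (mklin lu).
  apply: gen_sub_ind (gsM x) => e /= es; rewrite unfold_in /=.
  by have := us e es; rewrite unfold_in.
by rewrite unfold_in => /eqP.
Qed.

End SequenceAction.

(** * Chains of primes and regular sequences *)

Section PrimeChains.
Variables (R : comNzRingType) (M : lmodType R).
Implicit Types (p q : pred R) (s : seq R).

Definition strict_sub p q := {subset p <= q} /\ ~ {subset q <= p}.

Definition chain_of (d : nat) (c : nat -> pred R) :=
  (forall i, (i <= d)%N -> prime_ideal (c i) /\ {subset annihilator M <= c i}) /\
  (forall i, (i < d)%N -> strict_sub (c i) (c i.+1)).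

Lemma chain_glue a b c1 c2 : chain_of a c1 -> chain_of b c2 -> strict_sub (c1 a) (c2 0) ->
  prime_chain M (a + b).+1.
Proof.
move=> [p1 s1] [p2 s2] s12; exists (fun i => if (i <= a)%N then c1 i else c2 (i - a.+1)%N); split=> i ib.
  have [ia|ai] := leqP i a; first exact: p1.
  by apply: p2; rewrite leq_subLR addSn.
have [ia|ai] := ltnP i a; first by rewrite (ltnW ia); exact: s1.
have [ia|ia] := eqVneq i a; first by rewrite ia leqnn subnn.
have {}ai : (a < i)%N by rewrite ltn_neqAle eq_sym ia.
rewrite leqNgt ai /= subSn //; apply: s2.
by rewrite ltn_subLR // addSn.
Qed.

Lemma chain_glue_eq a b c1 c2 : chain_of a c1 -> chain_of b c2 -> c1 a = c2 0%N ->
  prime_chain M (a + b).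
Proof.
case: a => [|a] [p1 s1] h2 e; first by exists c2.
rewrite addSn; apply: (@chain_glue a b c1 c2) => //.
  by split=> i ia; [apply: p1|apply: s1]; rewrite ltnW.
by rewrite -e; exact: s1.
Qed.

End PrimeChains.

Section RegularChains.
Variables (R : comNzRingType) (m : ideal R) (M : lmodType R).
Hypotheses (nR : noetherian_ring R) (lR : local_ring m) (fgM : fin_gen M).
Implicit Types (a : ideal R) (p q : pred R) (s : seq R).

(** With the last element r removed, p still supports the quotient and so contains an associated
    prime q of it. As r is a nonzerodivisor there, it lies in p but not in q, and the induction
    continues below q. *)
Lemma chain_down s p : weakly_regular M s -> prime_ideal p -> {subset annihilator M <= p} ->
  (forall r, r \in s -> r \in p) -> exists c, chain_of M (size s) c /\ c (size s) = p.
Proof.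
elim/last_ind: s p => [|s r IH] p.
  by move=> _ pp Mp _; exists (fun=> p).
move=> /weakly_regular_rcons[ws wr] pp Mp sp.
have sp' c : c \in s -> c \in p by move=> cs; apply: sp; rewrite mem_rcons inE cs orbT.
have [c0|v vp] := @fin_gen_support R (quom (seq_act M s)) p (fin_gen_quom (seq_act M s) fgM) pp.
  move=> c0N; apply: (@seq_act_support R M fgM p s) => // x.
  by apply/quom_pi_eq0; rewrite linearZ; exact: c0N.
have [q [qA qp _]] := Ass_between nR pp vp.
have [qs qM] := Ass_quom_seq_act qA.
have /AssP[qprime [y yq]] := qA.
have rq : r \notin q.
  apply/negP => /yq /wr y0; move/negP: (prime_1 qprime); apply; apply/yq.
  by rewrite y0 scaler0.
have [c [[c1 c2] cq]] := IH q ws qprime qM qs.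
exists (fun i => if (i <= size s)%N then c i else p); rewrite size_rcons ltnn; split=> //.
split=> i is_; first by case: ifP => h; [exact: c1|].
rewrite ltnS in is_; rewrite is_; case: ltnP => h; first exact: c2.
have -> : i = size s by apply/eqP; rewrite eqn_leq is_.
rewrite cq; split=> // pq; move/negP: rq; apply; apply: pq; apply: sp.
by rewrite mem_rcons mem_head.
Qed.

(* If [p] kills [v] in [M/sM], the submodule [0 :_(M/sM) p] is not contained in
   [r (M/sM)], for otherwise it would be equal to [r] times itself. *)
Lemma Ass_rcons s r p : Ass (quom (seq_act M s)) p ->
  nonzerodivisor (quom (seq_act M s)) r -> r \in m ->
  exists q, Ass (quom (seq_act M (rcons s r))) q /\ strict_sub p q.
Proof.
move=> /AssP[pp [y yp]] /nonzerodivisor_quom rnz rm.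
have [v vE] := quom_piE y; rewrite {y}vE in yp.
have {}yp c : c \in p <-> c *: v \in seq_act M s by rewrite yp -linearZ quom_pi_eq0.
pose D (u : M) := forall c, c \in p -> c *: u \in seq_act M s.
have DP : D 0 /\ forall (b : R) u w, D u -> D w -> D (b *: u + w).
  split; first by move=> c _; rewrite scaler0 rpred0.
  move=> b u w Du Dw c cp; rewrite scalerDr scalerA mulrC -scalerA.
  by apply: rpredD; [apply/rpredZ/Du|exact: Dw].
have [u [Du us]] : exists u, D u /\ u \notin seq_act M (rcons s r).
  apply: contrapT => no; have {}no u : D u -> u \in seq_act M (rcons s r).
    by move=> Du; apply: contrapT => /negP us; apply: no; exists u.
  have [gs gsE] := fin_gen_noeth nR fgM (psub DP).
  have [|e egs|c cm cgs] := nakayama_prime (I := m) (W := seq_act M s) (s := gs)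
      (prime_max nR lR) _ (one_notin_max lR); first by [].
    have /psubP De : e \in psub DP by rewrite gsE; exact: mem_gen_sub.
    have /seq_act_rconsP[w [z [ws eE]]] := no e De.
    exists w => //; rewrite scale1r eE [w + _]addrC addrK.
    apply: mem_gen_sub; exists r, z; split=> //; rewrite -gsE; apply/psubP => c cp.
    apply: rnz; rewrite scalerA mulrC -scalerA.
    have -> : c *: (r *: z) = c *: e - c *: w by rewrite -scalerBr eE [w + _]addrC addrK.
    by apply: submodB; [exact: De|exact: rpredZ].
  have [d dc] := notin_max_inv nR lR cm.
  move/negP: (prime_1 pp); apply; apply/yp; rewrite -dc -scalerA; apply: rpredZ.
  have : v \in gen_sub [set` gs] by rewrite -gsE; apply/psubP => c' /yp.
  have cP : c *: (0 : M) \in seq_act M s /\ forall b (x z : M), c *: x \in seq_act M s ->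
      c *: z \in seq_act M s -> c *: (b *: x + z) \in seq_act M s.
    split; first by rewrite scaler0 rpred0.
    move=> b x z cx cz; rewrite scalerDr scalerA mulrC -scalerA.
    by apply: rpredD => //; exact: rpredZ.
  move=> vg; have : v \in @psub R M (fun x => c *: x \in seq_act M s) cP.
    by apply: gen_sub_ind vg => e /= es; apply/psubP; exact: cgs.
  by move/psubP.
have [|q [qA qu]] := @Ass_above R m nR lR _ (quom_pi (seq_act M (rcons s r)) u).
  by move=> /quom_pi_eq0; rewrite (negPf us).
have qk c : c *: u \in seq_act M (rcons s r) -> c \in q.
  by move=> cu; apply: qu; rewrite -linearZ; apply/quom_pi_eq0.
exists q; split=> //; split.
  move=> c cp; apply: qk; apply/seq_act_rconsP; exists (c *: u), 0.
  by rewrite scaler0 addr0; split=> //; exact: Du.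
move=> qp; have /yp /rnz vs : r \in p.
  by apply: qp; apply: qk; apply: seq_act_scale; rewrite mem_rcons mem_head.
by move/negP: (prime_1 pp); apply; apply/yp; rewrite scale1r.
Qed.

Lemma weakly_regular_catl s s' : weakly_regular M (s ++ s') -> weakly_regular M s.
Proof.
move=> h i si; have := h i; rewrite size_cat nth_cat si take_cat si; apply.
exact: leq_trans si (leq_addr _ _).
Qed.

Lemma chain_up s s' p : weakly_regular M (s ++ s') -> (forall r, r \in s' -> r \in m) ->
  Ass (quom (seq_act M s)) p -> exists c, chain_of M (size s') c /\ c 0%N = p.
Proof.
elim: s' s p => [|r s' IH] s p h sm pA.
  exists (fun=> p); split=> //; split=> [i _|i]; last by rewrite ltn0.
  by have [_ pM] := Ass_quom_seq_act pA; case/AssP: pA.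
rewrite -cat_rcons in h; have /weakly_regular_rcons[_ wr] := weakly_regular_catl h.
have [q [qA pq]] := Ass_rcons pA wr (sm r (mem_head _ _)).
have [|c [[c1 c2] c0]] := IH _ q h _ qA; first by move=> x xs; apply: sm; rewrite inE xs orbT.
exists (fun i => if i is j.+1 then c j else p); split=> //; split=> -[|i] //= is_.
- by have [_ pM] := Ass_quom_seq_act pA; case/AssP: pA.
- exact: c1.
- by rewrite c0.
- exact: c2.
Qed.

Hypothesis M0 : exists x : M, x != 0.

Lemma annihilator_sub_max : {subset annihilator M <= m}.
Proof.
move=> r /asboolP rM; apply: contrapT => /negP /(notin_max_inv nR lR)[s sr].
have [x /eqP x0] := M0; apply: x0.
by rewrite -[x]scale1r -sr -scalerA rM scaler0.
Qed.

Lemma seq_act_proper s : (forall r, r \in s -> r \in m) -> exists x : M, x \notin seq_act M s.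
Proof.
move=> sm; apply: contrapT => no; move/negP: (one_notin_max lR); apply.
apply: (@seq_act_support R M fgM _ s 1 (prime_max nR lR) annihilator_sub_max sm) => x.
by apply: contrapT => /negP xs; apply: no; exists (1 *: x).
Qed.

Variable d : nat.
Hypotheses (grM : is_grade m M d) (dimM : is_dim M d).

Lemma weakly_regular_size s : weakly_regular M s -> (forall r, r \in s -> r \in m) ->
  (size s <= d)%N.
Proof.
move=> ws sm; have [c [cc _]] := chain_down ws (prime_max nR lR) annihilator_sub_max sm.
by apply: dimM.2; exists c.
Qed.

Lemma regular_extend a s : {subset a <= m} -> weakly_regular M s -> (forall r, r \in s -> r \in a) ->
  exists s', maximal_regular_seq a M (s ++ s').
Proof.
move=> am; have [n] := ubnP (d - size s); elim: n s => // n IH s sn ws sa.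
have [mx|nmx] := pselect (maximal_regular_seq a M s); first by exists [::]; rewrite cats0.
have [r [ra rs]] : exists r, r \in a /\ regular_seq M (rcons s r).
  apply: contrapT => no; apply: nmx; split=> //; last by move=> r ra rs; apply: no; exists r.
  by split=> //; apply: seq_act_proper => r /sa /am.
have sra x : x \in rcons s r -> x \in a by rewrite mem_rcons inE => /orP[/eqP ->//|/sa].
have [|||s' s'P] := IH (rcons s r) => //; last by exists (r :: s'); rewrite -cat_rcons.
  rewrite size_rcons; have := @weakly_regular_size (rcons s r) rs.1 (fun x xs => am _ (sra _ xs)).
  rewrite size_rcons => sd; rewrite ltnS in sn; apply: leq_trans sn.
  by rewrite ltn_sub2l.
exact: rs.1.
Qed.

(** Let s ++ s' be maximal regular in m, of length d. A strict inclusion of q in p would join a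
    chain of length |s| ending at q to one of length |s'| starting at p, giving length d + 1 > dim
    M. *)
Lemma Ass_antichain s p q : weakly_regular M s -> (forall r, r \in s -> r \in m) ->
  Ass (quom (seq_act M s)) p -> Ass (quom (seq_act M s)) q ->
  {subset q <= p} -> {subset p <= q}.
Proof.
move=> ws sm pA qA qp; apply: contrapT => npq.
have [s' sP] := regular_extend (fun x xm => xm) ws sm.
have [sm' [ws' _] _] := sP; have [_ _ /(_ _ sP)] := grM; rewrite size_cat => sd.
have [qs qM] := Ass_quom_seq_act qA; have /AssP[qprime _] := qA.
have [c1 [cc1 c1E]] := chain_down ws qprime qM qs.
have [|c2 [cc2 c2E]] := chain_up ws' _ pA.
  by move=> r rs; apply: sm'; rewrite mem_cat rs orbT.
have := dimM.2 _ (chain_glue cc1 cc2 _); rewrite c1E c2E sd ltnn => h.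
by have := h (conj qp npq).
Qed.

(** Otherwise prime avoidance gives an element of a outside all associated primes of M/sM, which
    prolongs s. *)
Lemma maximal_regular_sub_Ass a s : {subset a <= m} -> maximal_regular_seq a M s ->
  exists p, Ass (quom (seq_act M s)) p /\ {subset a <= p}.
Proof.
move=> am [sa [ws _] smax]; apply: contrapT => no.
have fgN : noeth_mod (quom (seq_act M s)) by apply: fin_gen_noeth => //; exact: fin_gen_quom.
have /finite_seqP[ps psE] := Ass_finite nR lR fgN.
have psA p : p \in ps -> Ass (quom (seq_act M s)) p by move=> pps; rewrite psE.
have [p /psA/AssP[]//|p /psA pA|y ya yps] := prime_avoidance (I := a) (ps := ps).
  apply: contrapT => ap; apply: no; exists p; split=> // x xa.
  by apply: contrapT => /negP xp; apply: ap; exists x.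
have sya x : x \in rcons s y -> x \in a by rewrite mem_rcons inE => /orP[/eqP ->//|/sa].
apply: (smax y ya); split; last by apply: seq_act_proper => x /sya /am.
apply/weakly_regular_rcons; split=> //; apply: contrapT => /(zerodivisor_Ass nR lR)[p [pA yp]].
have : p \in ps by move: pA; rewrite psE.
by move=> /yps; rewrite yp.
Qed.

(** Some associated prime p of M/sM contains a. A chain of length |s'| ends at p, and one of length
    d - |s| starts there because s extends to length d inside m. Their union has length at most
    d. *)
Lemma maximal_regular_size a s s' : {subset a <= m} -> maximal_regular_seq a M s ->
  weakly_regular M s' -> (forall r, r \in s' -> r \in a) -> (size s' <= size s)%N.
Proof.
move=> am mx ws' s'a; have [p [pA ap]] := maximal_regular_sub_Ass am mx.
have [sa [ws _] _] := mx.
have [t tP] := regular_extend (fun x xm => xm) ws (fun r rs => am _ (sa _ rs)).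
have [tm [wt _] _] := tP; have [_ _ /(_ _ tP)] := grM; rewrite size_cat => sd.
have [_ pM] := Ass_quom_seq_act pA; have /AssP[pprime _] := pA.
have [c1 [cc1 c1E]] := chain_down ws' pprime pM (fun r rs => ap _ (s'a _ rs)).
have [|c2 [cc2 c2E]] := chain_up wt _ pA.
  by move=> r rs; apply: tm; rewrite mem_cat rs orbT.
have := dimM.2 _ (chain_glue_eq cc1 cc2 _); rewrite c1E c2E -sd leq_add2r => h.
exact: h.
Qed.

Lemma ideal_act_proper a : {subset a <= m} -> exists x, x \notin ideal_act a (full_sub M).
Proof.
move=> am; apply: contrapT => no; have [gs gsM] := fgM.
have [e _|u um us] := nakayama_prime (V := M) (W := zero_sub M) (s := gs)
    (prime_max nR lR) am (one_notin_max lR).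
  exists 0; first exact: rpred0.
  rewrite subr0 scale1r; have : e \in ideal_act a (full_sub M).
    by apply: contrapT => /negP ea; apply: no; exists e.
  by apply: gen_sub_ind => _ [r [x [ra _ ->]]]; apply: mem_gen_sub; exists r, x.
move/negP: um; apply; apply: annihilator_sub_max; apply/asboolP => x.
have lu : linear ( *:%R u : M -> M) by move=> b v w; rewrite scalerDr !scalerA mulrC.
have : x \in ker_sub (mklin lu).
  apply: gen_sub_ind (gsM x) => e /= es; rewrite unfold_in /=.
  by have := us e es; rewrite unfold_in.
by rewrite unfold_in => /eqP.
Qed.

Lemma grade_exists a : {subset a <= m} -> exists s, maximal_regular_seq a M s /\ is_grade a M (size s).
Proof.
move=> am; have [s sP] : exists s, maximal_regular_seq a M s.
  have w0 : weakly_regular M [::] by move=> i; rewrite ltn0.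
  have [|s sP] := regular_extend am w0; first by [].
  by exists s.
exists s; split=> //; split; [exact: ideal_act_proper|by exists s|].
move=> s' s'P; have [sa [ws _] _] := sP; have [sa' [ws' _] _] := s'P.
by apply/eqP; rewrite eqn_leq !(maximal_regular_size am).
Qed.

End RegularChains.

(** * Vanishing of local cohomology *)

Section AddGenerators.
Variable R : comNzRingType.
Implicit Types (a b I J : ideal R) (M V : lmodType R) (s : seq R).

Definition ideal_adds I s : ideal R := foldr (fun y J => ideal_addp J y) I s.

Lemma ideal_adds_base I s : {subset I <= ideal_adds I s}.
Proof. by elim: s => //= y s IH x /IH; exact: ideal_addpl. Qed.

Lemma mem_ideal_adds I s z : z \in s -> z \in ideal_adds I s.
Proof.
elim: s => //= y s IH; rewrite inE => /orP[/eqP ->|/IH]; last exact: ideal_addpl.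
by have := ideal_addpr (ideal_adds I s) y 1; rewrite mul1r.
Qed.

Lemma ideal_adds_sub I J s : {subset I <= J} -> (forall z, z \in s -> z \in J) ->
  {subset ideal_adds I s <= J}.
Proof.
move=> IJ; elim: s => //= y s IH sJ x /ideal_addpP[u [r [us ->]]]; apply: idealD.
  by apply: IH us => z zs; apply: sJ; rewrite inE zs orbT.
by apply: ideal_mul; apply: sJ; exact: mem_head.
Qed.

Lemma ideal_adds_exp_sub I b s : (exists k, {subset ideal_exp I k <= b}) ->
  (forall z, z \in s -> exists k, z ^+ k \in b) ->
  exists k, {subset ideal_exp (ideal_adds I s) k <= b}.
Proof.
move=> [k0 Ik]; elim: s => [|y s IH] sb; first by exists k0.
have [|k kP] := IH; first by move=> z zs; apply: sb; rewrite inE zs orbT.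
have [l lP] := sb y (mem_head _ _); exists (k + l)%N => x.
by move=> /ideal_exp_addp /ideal_addpP[u [r [/kP ub ->]]]; apply: idealD => //; exact: ideal_mul.
Qed.

Hypothesis nR : noetherian_ring R.

Lemma noetherian_colon_stable a (y : R) : colon_stable a y.
Proof.
move=> n; apply: (noeth_chain (F := fun m => ideal_colon (ideal_exp a n) (y ^+ m))
  (noeth_regular nR)) => m x.
by rewrite !ideal_colonP exprS -mulrA; exact: ideal_mul.
Qed.

Lemma projective_regular_quom I : (forall x, x \in I -> x = 0) -> projective (quom I).
Proof.
move=> I0 A B q f qs; have [w wE] := qs (f (quom_pi I 1)).
have lw : linear (fun x : R^o => (x : R) *: w).
  by move=> c u v; rewrite scalerDl -[c *: u]/(c * u) scalerA.
have [||g gE] := @lin_factor_surj R _ _ _ (quom_pi I) (mklin lw).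
- by move=> u; have [x ->] := quom_piE u; exists x.
- by move=> x /quom_pi_eq0 /I0 ->; rewrite /= scale0r.
exists g => u; have [x ->] := quom_piE u; rewrite gE /= linearZ wE -linearZ.
by rewrite -linearZ -[_ *: _]/(x * 1) mulr1.
Qed.

Lemma lc_zero_vanish i M (xi : local_cohomology (zero_sub R^o : ideal R) i.+1 M) : xi = 0.
Proof.
have [n [g ->]] := lc_surj xi; apply/lc_eq0.
(* The exponent must be positive: the zeroth power of the zero ideal is R, while all others are 0
   and leave the projective module R. *)
have [f f1] := sub_mulby (@ideal_exp_antimono R (zero_sub R^o) _ _ (leqnSn n)).
exists n.+1, f; split=> //; apply: syz_proj_triv; apply: projective_regular_quom => x.
move=> x0; suff : x \in zero_sub R^o by rewrite unfold_in => /eqP.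
apply: ideal_exp_ind x0 => r z; rewrite [r \in _]unfold_in => /eqP -> _.
by rewrite mul0r ideal0.
Qed.

Lemma lc_adds_vanish s i M (xi : local_cohomology (ideal_adds (zero_sub R^o) s) i M) :
  (size s < i)%N -> xi = 0.
Proof.
elim: s i xi => [|y s IH] [|i] xi si; [by []|exact: lc_zero_vanish|by []|].
have [|eta e] := @lc_addp_ann_sub _ (ideal_adds (zero_sub R^o) s) y M
    (@noetherian_colon_stable _ _) i _ xi.
  by move=> z; exists 0%N; rewrite expr0 scale1r; exact: IH.
by rewrite -[xi]scale1r; apply/e; rewrite (IH _ eta) ?scaler0 //; exact: ltnW.
Qed.

Lemma lc_killed a i M z (xi : local_cohomology a i M) : (forall x : M, z *: x = 0) -> z *: xi = 0.
Proof.
move=> zM; have [n [g ->]] := lc_surj xi; apply/lc_scale_eq0; exists n, idfun.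
split=> [x|]; first by rewrite mul1r.
by apply: triv_ext (triv0 _ _ _) => x /=; rewrite zM.
Qed.

Lemma lc_adds_killed a s i M : (forall z (x : M), z \in s -> z *: x = 0) ->
  ann_sub (local_cohomology a i.+1 M) (local_cohomology (ideal_adds a s) i.+1 M) /\
  ann_sub (local_cohomology (ideal_adds a s) i.+1 M) (local_cohomology a i.+1 M).
Proof.
elim: s => [|y s IH] sM; first by split=> xi; exists xi.
have [|h1 h2] := IH; first by move=> z x zs; apply: sM; rewrite inE zs orbT.
have tors j : power_torsion (local_cohomology (ideal_adds a s) j M) y.
  by move=> xi; exists 1%N; apply: lc_killed => x; apply: sM; exact: mem_head.
split=> xi.
  have [eta e] := h1 xi.
  have [th t] := @lc_addp_ann_sub_rev _ _ y M (@noetherian_colon_stable _ _) i (tors i) (tors i.+1) eta.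
  by exists th => r; exact: iff_trans (e r) (t r).
have [eta e] := @lc_addp_ann_sub _ _ y M (@noetherian_colon_stable _ _) i (tors i) xi.
by have [th t] := h2 eta; exists th => r; exact: iff_trans (e r) (t r).
Qed.

(** Multiplication by y^l from R/a^N to R/a^n factors through a quotient of R by a power of b, where
    the class is already zero. This stands for the agreement of both cohomologies after inverting
    y. *)
Lemma lc_power_torsion a b (y : R) j M : {subset b <= a} ->
  (forall xi : local_cohomology b j M, xi = 0) ->
  (forall n, exists l N, forall x, x \in ideal_exp a N -> y ^+ l * x \in ideal_exp b n) ->
  power_torsion (local_cohomology a j M) y.
Proof.
move=> ba Hb yab xi; have [n [g ->]] := lc_surj xi.
have [e e1] := sub_mulby (ideal_exp_mono (n := n) ba).
have /lc_eq0[N' [f [f1 t]]] := Hb (lc (g \o syz_map e j)).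
have [l [N0 lN0]] := yab N'.
have [s sl] : exists s : {linear quom (ideal_exp a (N0 + n)) -> quom (ideal_exp b N')}, mulby (y ^+ l) s.
  by apply: mulby_ex => x /(@ideal_exp_antimono _ a _ _ (leq_addr n N0)); exact: lN0.
have [p p1] := sub_mulby (@ideal_exp_antimono _ a _ _ (leq_addl N0 n)).
exists l; apply/lc_scale_eq0; exists (N0 + n)%N, p; split=> //.
have [h hl] : exists h : {linear quom (ideal_exp a (N0 + n)) -> quom (ideal_exp a n)}, mulby (y ^+ l) h.
  by exists (e \o (f \o s)) => x; rewrite /= sl f1 e1 !mul1r.
have [k k1] : exists k : {linear quom (ideal_exp b N') -> quom (ideal_exp a n)}, mulby 1 k.
  by exists (e \o f) => x; rewrite /= f1 e1 !mul1r.
apply/(triv_mulby g hl p1); apply/(triv_mulby_comp g sl k1 (h := h)); first by rewrite mul1r.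
by apply: triv_lift (syz_map_lift s) _; apply/(triv_sub_comp g f1 e1 k1).
Qed.

Lemma power_torsion_exp a b (y : R) gs :
  (a : {pred R^o}) =i gen_sub [set` (gs : seq R^o)] ->
  (forall g, g \in gs -> exists k, (y * g) ^+ k \in b) ->
  forall n, exists l N, forall x, x \in ideal_exp a N -> y ^+ l * x \in ideal_exp b n.
Proof.
move=> agen gb n; pose c := ideal_adds (zero_sub R^o) [seq y * g | g <- gs].
have [||k ck] := @ideal_adds_exp_sub (zero_sub R^o) (ideal_exp b n) [seq y * g | g <- gs].
- exists 1%N; apply: ideal_exp_ind => r x; rewrite [r \in _]unfold_in => /eqP -> _.
  by rewrite mul0r ideal0.
- move=> _ /mapP[g /gb[k kb] ->]; exists (k * n)%N; rewrite exprM; exact: ideal_exp_pow.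
(* The same k serves twice, since y^k a^k lies in the k-th power of the ideal [c] generated by the
   products y * g. *)
exists k, k => x xk; apply: ck; rewrite -/c.
have ya z : z \in a -> y * z \in c.
  rewrite agen -ideal_colonP; apply: gen_sub_ind => g gg; rewrite ideal_colonP.
  by apply: mem_ideal_adds; exact: map_f.
elim: k x xk => [|k IH] // x.
rewrite -ideal_colonP; move: x; apply: ideal_exp_ind => r x ra xk.
by rewrite ideal_colonP exprS mulrACA; apply: ideal_expS; [exact: ya|exact: IH].
Qed.

End AddGenerators.

(** * Degrees up to the grade *)

Section LowDegree.
Variables (R : comNzRingType) (a : ideal R).
Implicit Types V W : lmodType R.

Local Notation H i V := (local_cohomology a i V).
Local Notation E n := (quom (ideal_exp a n)).

Lemma lc_elem_torsion i V (xi : H i V) x : x \in a -> exists n, x ^+ n *: xi = 0.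
Proof.
move=> xa; have [n [g ->]] := lc_surj xi; exists n; apply: lc_torsion.
exact: ideal_exp_pow.
Qed.

Lemma lc_eq0_pow i V x : x \in a -> (forall xi : H i V, x *: xi = 0 -> xi = 0) ->
  forall xi : H i V, xi = 0.
Proof.
move=> xa h xi; have [n] := lc_elem_torsion xi xa; elim: n xi => [|n IH] xi.
  by rewrite expr0 scale1r.
by rewrite exprSr -scalerA => /IH /h.
Qed.

Lemma Ass_lc_mem i V p x : Ass (H i V) p -> x \in a -> x \in p.
Proof.
move=> /AssP[pp [xi xip]] xa; have [n xn] := lc_elem_torsion xi xa.
by apply: (prime_exp pp (k := n)); apply/xip.
Qed.

Lemma idfun_mulby n : mulby 1 (idfun : {linear E n -> E n}).
Proof. by move=> x; rewrite mul1r. Qed.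

(** In degree 0 a class is a linear map from R/a^n, and its annihilator is that of the image of
    1. *)
Lemma lc0_Ass V p : Ass (H 0 V) p -> Ass V p.
Proof.
apply: ann_sub_Ass => xi; have [n [g ->]] := lc_surj xi.
exists (g (quom_pi (ideal_exp a n) 1)) => r; split.
  move=> /lc_scale_eq0[N [f [f1 t]]].
  have {}t (z : E N) : r *: g (f z) = 0 by exact: t.
  by have := t (quom_pi (ideal_exp a N) 1); rewrite f1 mulr1.
move=> r0; apply/lc_scale_eq0; exists n, idfun; split; first exact: idfun_mulby.
move=> z /=; have [y ->] := quom_piE z.
have -> : quom_pi (ideal_exp a n) y = (y : R) *: quom_pi (ideal_exp a n) 1.
  by rewrite -linearZ -[_ *: _]/(y * 1) mulr1.
by rewrite linearZ scalerA mulrC -scalerA r0 scaler0.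
Qed.

Lemma lc0_eq0 V x : x \in a -> nonzerodivisor V x -> forall xi : H 0 V, xi = 0.
Proof.
move=> xa xnz; apply: (lc_eq0_pow xa) => xi; have [n [g ->]] := lc_surj xi.
move=> /(iffLR (@lc_scale_eq0 R a 0 V n x g))[N [f [f1 t]]].
apply/lc_eq0; exists N, f; split; first exact: f1.
move=> z; exact: xnz (t z).
Qed.

Section NonzerodivisorStep.
Variables (V W : lmodType R) (pi : {linear V -> W}) (x : R).
Hypotheses (xa : x \in a) (xnz : nonzerodivisor V x) (spi : surj_lin pi).
Hypothesis ker_pi : forall v, pi v = 0 <-> exists w, v = x *: w.

Let scale_x_inj : injective (fun v : V => x *: v).
Proof. by move=> u v /eqP; rewrite -subr_eq0 -scalerBr => /eqP/xnz/eqP; rewrite subr_eq0 => /eqP. Qed.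

Let scale_x : {linear V -> V} := mklin (fun b (u v : V) =>
  etrans (scalerDr x (b *: u) v) (congr1 (+%R^~ _) (etrans (scalerA x b u)
    (etrans (congr1 ( *:%R^~ u) (mulrC x b)) (esym (scalerA b x u)))))).

(** A trivial [u] extends to a map on a free module, and that extension lifts through [pi].
    Composing the lift with the differential makes it vanish on the next syzygy. *)
Lemma triv_aug_lift j N (u : {linear syz N j -> W}) : @triv R (free_resol N) j W u ->
  exists l : {linear free_res N j -> V}, (forall z, l (syz_incl N j z) = 0) /\
    forall v, pi (l v) = u (aug (syz N j) v).
Proof.
case: j u => [|j] u t.
  by exists \0; split=> // v; rewrite linear0 (t (aug _ v)).
have [lb lbE] := t; have [l0 l0E] := @projective_free R _ _ _ pi lb spi.
exists (l0 \o (syz_incl N j \o aug (syz N j.+1))); split=> v /=.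
  by rewrite (eqP (valP v)) !linear0.
by rewrite l0E lbE.
Qed.

(* The connecting homomorphism of 0 -> V -> V -> W -> 0, inverted on the kernel of [x]. *)
Lemma lc_connecting j (xi : H j.+1 V) : (forall zeta : H j V, zeta = 0) -> x *: xi = 0 ->
  exists eta : H j W, forall r, r *: xi = 0 <-> r *: eta = 0.
Proof.
move=> Hj; have [n [g ->]] := lc_surj xi.
move=> /lc_scale_eq0[N [f [f1 [h hE]]]]; pose g1 := g \o syz_map f j.+1.
have {}hE s : x *: g1 s = h (syz_incl (E N) j s) by exact: hE.
(* Modulo x the map [h] vanishes on the next syzygy, so it descends to a map from the j-th syzygy to
   W, which represents [eta]. *)
have [||gb gbE] := @lin_factor_surj R _ _ _ (aug (syz (E N) j)) (pi \o h).
- exact: aug_surj.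
- move=> v /can_exact[s ->]; rewrite /= -hE; apply/ker_pi; by exists (g1 s).
exists (lc gb) => r; apply: (iff_trans (iff_sym (lc_sub_scale r g f1))).
split=> /lc_scale_eq0[N1 [p [p1 t]]].
  have [k kE] := t.
  have {}kE s : r *: g1 (syz_map p j.+1 s) = k (syz_incl (E N1) j s) by exact: kE.
  (* [l] lifts r times [gb] to V. It represents a class of degree j, which vanishes by hypothesis,
     and so does its image under [pi]. *)
  have [||l lE] := @lin_factor_surj R _ _ _ (aug (syz (E N1) j))
      ((r \*: (h \o res_map p j)) \- (x \*: k)).
  - exact: aug_surj.
  - move=> v /can_exact[s ->].
    rewrite -[LHS]/(r *: h (syz_incl (E N) j (syz_map p j.+1 s)) - x *: k (syz_incl (E N1) j s)).
    by rewrite -kE -hE !scalerA mulrC subrr.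
  have /lc_eq0[N2 [q [q1 lq]]] := Hj (lc l).
  have [pq pq1] : exists pq : {linear E N2 -> E N}, mulby 1 pq.
    by exists (p \o q) => c; rewrite /= q1 p1 !mul1r.
  apply/lc_scale_eq0; exists N2, pq; split=> //.
  apply: (iffRL (triv_sub_comp (r \*: gb) q1 p1 pq1)).
  apply: triv_ext (triv_post pi lq) => z /=.
  have [v <-] := @aug_surj R (syz (E N1) j) (syz_map q j z).
  have e1 : pi (x *: k v) = 0 by apply/ker_pi; exists (k v).
  have e2 : gb (syz_map p j (aug (syz (E N1) j) v)) = pi (h (res_map p j v)).
    by rewrite -aug_free_map gbE.
  rewrite lE -[LHS]/(pi (r *: h (res_map p j v) - x *: k v)) linearB e1 subr0 linearZ.
  by rewrite -e2.
have [l [l1 l2]] : exists l : {linear free_res (E N1) j -> V},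
    (forall s, l (syz_incl (E N1) j s) = 0) /\
    (forall v, pi (l v) = r *: gb (syz_map p j (aug (syz (E N1) j) v))).
  exact: (triv_aug_lift (u := r \*: (gb \o syz_map p j)) t).
(* Corrected by the lift [l], r times [h] takes values in xV; its quotient by x extends r times [g1]
   to the free module. *)
have [||w wE] := @lin_factor_inj R _ _ _ scale_x ((r \*: (h \o res_map p j)) \- l).
- exact: scale_x_inj.
- move=> v; apply/ker_pi; rewrite /= linearB linearZ l2.
  by rewrite -[syz_map p j _]aug_free_map gbE subrr.
apply/lc_scale_eq0; exists N1, p; split=> //; exists w => s.
apply: scale_x_inj; rewrite -[RHS]/(scale_x (w (syz_incl (E N1) j s))) wE /= l1 subr0.
have -> : res_map p j (syz_incl (E N1) j s) = syz_incl (E N) j (syz_map p j.+1 s) by [].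
by rewrite -hE !scalerA mulrC.
Qed.

Lemma lc_step_eq0 j : (forall zeta : H j V, zeta = 0) -> (forall zeta : H j W, zeta = 0) ->
  forall xi : H j.+1 V, xi = 0.
Proof.
move=> Vj Wj; apply: (lc_eq0_pow xa) => xi /(lc_connecting Vj)[eta e].
by rewrite -[xi]scale1r; apply/e; rewrite (Wj eta) scaler0.
Qed.

Lemma lc_step_Ass j p : (forall zeta : H j V, zeta = 0) -> Ass (H j.+1 V) p -> Ass (H j W) p.
Proof.
move=> Vj pA; have xp := Ass_lc_mem pA xa; case/AssP: pA => pp [xi xip].
have [eta e] := lc_connecting Vj (iffLR (xip x) xp).
by apply/AssP; split=> //; exists eta => r; exact: iff_trans (xip r) (e r).
Qed.

End NonzerodivisorStep.

Lemma lc_iso_ann_sub i V W (f : {linear V -> W}) : injective f -> surj_lin f ->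
  ann_sub (H i V) (H i W).
Proof.
move=> fi fs; have [|h hE] := @lin_factor_inj R _ _ _ f idfun fi.
  by move=> w; have [v <-] := fs w; exists v.
move=> xi; have [n [g ->]] := lc_surj xi; exists (lc (f \o g)) => r.
split=> /lc_scale_eq0[N [p [p1 t]]]; apply/lc_scale_eq0; exists N, p; split=> //.
  by apply: triv_ext (triv_post f t) => z /=; rewrite linearZ.
apply: triv_ext (triv_post h t) => z /=; rewrite linearZ; congr (_ *: _).
by apply: fi; rewrite hE.
Qed.

Section RegularSequence.
Variable M : lmodType R.

Let Q (s : seq R) := quom (seq_act M s).

Fact seq_act_rcons_sub (s : seq R) r x : x \in seq_act M s -> idfun x \in seq_act M (rcons s r).
Proof.
by move=> xs; apply/seq_act_rconsP; exists x, 0; rewrite scaler0 addr0.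
Qed.

(** The induction runs on the elements still to be divided out: each of them lowers the
    cohomological degree by one and replaces the module by its quotient. *)
Lemma lc_regular_aux (s' s : seq R) : weakly_regular M (s ++ s') -> (forall r, r \in s' -> r \in a) ->
  (forall j, (j < size s')%N -> forall xi : H j (Q s), xi = 0) /\
  forall p, Ass (H (size s') (Q s)) p -> Ass (Q (s ++ s')) p.
Proof.
elim: s' s => [|r s' IH] s ws sa.
  by split=> // p; rewrite cats0; exact: lc0_Ass.
rewrite -cat_rcons in ws *.
have /weakly_regular_rcons[_ rnz] := weakly_regular_catl ws.
have [|IH1 IH2] := IH _ ws; first by move=> z zs; apply: sa; rewrite inE zs orbT.
have ra := sa r (mem_head _ _).
pose pi : {linear Q s -> Q (rcons s r)} := quom_map (@seq_act_rcons_sub s r).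
have piE x : pi (quom_pi _ x) = quom_pi _ x by exact: quom_map_pi.
have spi : surj_lin pi by move=> u; have [x ->] := quom_piE u; exists (quom_pi _ x).
have ker_pi v : pi v = 0 <-> exists w, v = r *: w.
  have [x ->] := quom_piE v; rewrite piE; split.
    move=> /quom_pi_eq0/seq_act_rconsP[w [z [ws' ->]]]; exists (quom_pi _ z).
    by rewrite -linearZ; apply/quom_pi_eq; rewrite addrK.
  move=> [w]; have [z ->] := quom_piE w; rewrite -linearZ => /quom_pi_eq xz.
  apply/quom_pi_eq0/seq_act_rconsP; exists (x - r *: z), z; split=> //.
  by rewrite subrK.
have van j : (j < size (r :: s'))%N -> forall xi : H j (Q s), xi = 0.
  elim: j => [_|j IHj js]; first exact: lc0_eq0 ra rnz.
  by apply: (lc_step_eq0 ra rnz spi ker_pi); [apply/IHj/ltnW|exact: IH1].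
split=> // p /(lc_step_Ass ra rnz spi ker_pi) h; apply: IH2; apply: h.
exact: van.
Qed.

Lemma lc_regular (s : seq R) : weakly_regular M s -> (forall r, r \in s -> r \in a) ->
  (forall j, (j < size s)%N -> forall p, ~ Ass (H j M) p) /\
  forall p, Ass (H (size s) M) p -> Ass (Q s) p.
Proof.
move=> ws sa; have [h1 h2] := @lc_regular_aux s [::] ws sa.
(* The recursion starts at the quotient by the empty sequence, which is isomorphic but not equal to
   M. *)
have iso i : ann_sub (H i M) (H i (Q [::])).
  apply: (@lc_iso_ann_sub _ _ _ (quom_pi (seq_act M [::]))) => [u v|u].
    by move=> /quom_pi_eq /seq_act_nil /eqP; rewrite subr_eq0 => /eqP.
  by have [x ->] := quom_piE u; exists x.
split=> [j js p /(ann_sub_Ass (iso j)) /AssP[pp [xi xip]]|p /(ann_sub_Ass (iso _)) /h2 //].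
by move/negP: (prime_1 pp); apply; apply/xip; rewrite (h1 j js xi) scaler0.
Qed.

End RegularSequence.

End LowDegree.

(** An element with annihilator p is killed by a, so 1 can be sent to it, and the resulting map has
    the same annihilator. The zero quotient puts this in the form in which [weakly_laskerian]
    speaks. *)
Lemma Ass_hom_quom (R : comNzRingType) (a : ideal R) (X : lmodType R) p : Ass X p ->
  {subset a <= p} -> Ass (quom (zero_sub (homm (quom a) X))) p.
Proof.
move=> /AssP[pp [xi xip]] ap; apply/AssP; split=> //.
have lx : linear (fun r : R^o => (r : R) *: xi).
  by move=> c u v; rewrite scalerDl -[c *: u]/(c * u) scalerA.
have [||f fE] := @lin_factor_surj R _ _ _ (quom_pi a) (mklin lx).
- by move=> u; have [x ->] := quom_piE u; exists x.
- by move=> x /quom_pi_eq0 /ap /xip.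
have lf : (f : quom a -> X) \in @hom_pred R (quom a) (X).
  by apply/asboolP => c u v; rewrite linearP.
exists (quom_pi _ (insubm lf)) => r; rewrite -linearZ; split=> [/xip r0|].
  apply/quom_pi_eq0; rewrite unfold_in; apply/eqP/val_inj/funext => u.
  have [x ->] := quom_piE u; rewrite -[LHS]/(r *: f (quom_pi a x)) fE /=.
  by rewrite scalerA mulrC -scalerA r0 scaler0.
move=> /quom_pi_eq0; rewrite unfold_in => /eqP/(congr1 val) f0; apply/xip.
have := congr1 (fun h : quom a -> X => h (quom_pi a 1)) f0.
by rewrite -[X in X = _ -> _]/(r *: f (quom_pi a 1)) fE /= scale1r.
Qed.

(** * Induction on the degree minus the grade *)

Section MainInduction.
Variables (R : comNzRingType) (m : ideal R) (M : lmodType R).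
Hypotheses (nR : noetherian_ring R) (lR : local_ring m) (fgM : fin_gen M).
Hypothesis M0 : exists x : M, x != 0.
Variable d : nat.
Hypotheses (grM : is_grade m M d) (dimM : is_dim M d).
Implicit Types (a : ideal R) (p q : pred R).

Local Notation H a i := (local_cohomology a i M).

Lemma Ass_lc_improper a i p : ~ {subset a <= m} -> ~ Ass (H a i) p.
Proof.
move=> am pA; apply: am; apply: (proper_sub_max nR lR); apply/negP => /(Ass_lc_mem pA).
by case/AssP: pA => pp _; apply/negP; exact: prime_1.
Qed.

(* An element separating the components of Supp M/sM inside V(a) from the others. *)
Lemma separating_element a s : weakly_regular M s -> (forall r, r \in s -> r \in m) ->
  exists y, forall p, Ass (quom (seq_act M s)) p -> (y \in p <-> ~ {subset a <= p}).
Proof.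
move=> ws sm; pose N := quom (seq_act M s).
pose D (x : R^o) := forall q, Ass N q -> ~ {subset a <= q} -> x \in q.
have DP : D 0 /\ forall (b : R) (u v : R^o), D u -> D v -> D (b *: u + v).
  split=> [q /AssP[qp _] _|b u v Du Dv q qA aq]; first exact: prime_0.
  have /AssP[qp _] := qA; apply: prime_lin => //; [exact: Du|exact: Dv].
have fgN : noeth_mod N by apply: fin_gen_noeth => //; exact: fin_gen_quom.
have /finite_seqP[qs qsE] := Ass_finite nR lR fgN.
have qsA q : (q \in qs) <-> Ass N q by rewrite qsE.
(* [D] is the intersection of the associated primes that do not contain a. By the antichain property
   none of these lies inside a prime that does contain a, so products of elements taken from them
   escape each such prime. *)
have [p|p|y yD yp] := prime_avoidance (I := psub DP) (ps := [seq p <- qs | `[< {subset a <= p} >]]).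
- by rewrite mem_filter => /andP[_ /qsA/AssP[]].
- rewrite mem_filter => /andP[/asboolP ap /qsA pA]; have /AssP[pp _] := pA.
  have [w [wp wD]] : exists w, w \notin p /\ forall q, q \in qs -> ~ {subset a <= q} -> w \in q.
    have : forall q, q \in qs -> Ass N q by move=> q /qsA.
    elim: (qs) => [|q rs IH] rsA; first by exists 1; split=> //; exact: prime_1.
    have [|w [wp wD]] := IH; first by move=> q' h; apply: rsA; rewrite inE h orbT.
    have qA := rsA q (mem_head _ _); have /AssP[qp _] := qA.
    have [aq|aq] := pselect {subset a <= q}.
      exists w; split=> // q'; rewrite inE => /orP[/eqP -> /(_ aq) //|]; exact: wD.
    have [z [zq zp]] : exists z, z \in q /\ z \notin p.
      apply: contrapT => nz; apply: aq => x /ap; apply: (Ass_antichain nR lR fgM M0 grM dimM ws sm pA qA).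
      by move=> z zq; apply: contrapT => /negP zp; apply: nz; exists z.
    exists (w * z); split; first exact: prime_notin_mul.
    move=> q'; rewrite inE => /orP[/eqP -> _|h aq']; first exact: prime_mull.
    have /AssP[q'p _] := rsA q' (mem_behead (s := q :: rs) h).
    by apply: prime_mulr => //; exact: wD.
  exists w => //; apply/psubP => q /qsA; exact: wD.
exists y => p pA; split=> [py ap|]; last exact: (psubP DP y yD).
have : p \in [seq p <- qs | `[< {subset a <= p} >]].
  by rewrite mem_filter; apply/andP; split; [exact/asboolP|exact/qsA].
by move=> /yp; rewrite py.
Qed.

(** The second property of [a'] yields, by prime avoidance, a nonzerodivisor on M/sM in [a'], hence
    a larger grade. The degree is [i.+2] because torsion is required in the two consecutive degrees
    i+1 and i+2, both above |s|. *)
Lemma lc_Ass_raise a s i : {subset a <= m} -> weakly_regular M s -> (forall r, r \in s -> r \in a) ->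
  (size s <= i)%N -> exists a', [/\ {subset a <= a'},
    forall p, Ass (quom (seq_act M s)) p -> ~ {subset a' <= p} &
    forall p, Ass (H a i.+2) p -> Ass (H a' i.+2) p].
Proof.
move=> am ws sa si; have sm r : r \in s -> r \in m by move=> /sa /am.
have [y yP] := separating_element a ws sm.
have annP : (0 : R^o) \in annihilator M /\ forall (b : R) (u v : R^o),
    u \in annihilator M -> v \in annihilator M -> b *: u + v \in annihilator M.
  split; first by apply/asboolP => x; rewrite scale0r.
  move=> b u v /asboolP u0 /asboolP v0; apply/asboolP => x.
  by rewrite scalerDl -[b *: u]/(b * u) -scalerA u0 v0 scaler0 addr0.
have [zs zsE] := nR (psub annP).
have zsM z (x : M) : z \in zs -> z *: x = 0.
  move=> zzs; have : z \in psub annP by rewrite zsE; exact: mem_gen_sub.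
  by move=> /(psubP annP)/asboolP.
have zsp p : {subset zs <= p} -> prime_ideal p -> {subset annihilator M <= p}.
  move=> zp pp r rM; have : r \in psub annP by apply/(psubP annP).
  rewrite zsE -(prime_idE pp); apply: gen_sub_ind => z zzs; rewrite prime_idE; exact: zp.
(* With Ann M included, every prime above [b] lies in the support of M/sM, so the radical comparison
   below can be made over all primes of R. *)
pose a1 := ideal_adds a zs; pose b := ideal_adds (ideal_adds (zero_sub R^o) s) zs.
have ba1 : {subset b <= a1}.
  apply: ideal_adds_sub => [|z]; last exact: mem_ideal_adds.
  apply: ideal_adds_sub => [x|r /sa]; last exact: ideal_adds_base.
  by rewrite unfold_in => /eqP ->; exact: ideal0.
have Hb j : (size s < j.+1)%N -> forall xi : H b j.+1, xi = 0.
  move=> sj xi; have [_ h] := @lc_adds_killed _ nR (ideal_adds (zero_sub R^o) s) zs j M zsM.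
  have [eta e] := h xi; rewrite -[xi]scale1r; apply/e.
  by rewrite (@lc_adds_vanish _ nR s j.+1 M eta sj) scaler0.
have rad g : g \in a1 -> exists k, (y * g) ^+ k \in b.
  move=> ga1; apply: (radical_mem nR) => p pp bp.
  have zp : {subset zs <= p} by move=> z zzs; apply: bp; exact: mem_ideal_adds.
  have Mp := zsp p zp pp.
  have sp r : r \in s -> r \in p.
    by move=> rs; apply: bp; apply: ideal_adds_base; exact: mem_ideal_adds.
  have [r rN|v vp] := fin_gen_support (fin_gen_quom (seq_act M s) fgM) pp.
    apply: (seq_act_support fgM pp Mp sp) => x.
    by apply/quom_pi_eq0; rewrite linearZ; exact: rN.
  (* Below p there is an associated prime q of M/sM. If q contains a, then p contains [a1] and so
     [g]; otherwise [y] lies in q. *)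
  have [q [qA qp _]] := Ass_between nR pp vp.
  have [aq|aq] := pselect {subset a <= q}; last first.
    by apply: prime_mulr => //; apply: qp; apply/yP.
  apply: prime_mull => //; move: ga1; rewrite -(prime_idE pp).
  by apply: ideal_adds_sub => [x /aq /qp|z /zp]; rewrite prime_idE.
have [gs gsE] := nR a1.
have tors j : (size s < j.+1)%N -> power_torsion (H a1 j.+1) y.
  move=> sj; apply: (lc_power_torsion ba1 (Hb j sj)).
  apply: (power_torsion_exp gsE) => g ggs; apply: rad; rewrite gsE; exact: mem_gen_sub.
exists (ideal_addp a1 y); split.
- by move=> x /(@ideal_adds_base _ a zs); exact: ideal_addpl.
- move=> p pA a'p; have [aq|aq] := pselect {subset a <= p}.
    have /(yP p pA) : y \in p by apply: a'p; have := ideal_addpr a1 y 1; rewrite mul1r.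
    by apply.
  by apply: aq => x xa; apply: a'p; apply: ideal_addpl; exact: ideal_adds_base.
move=> p pA; have [h1 _] := @lc_adds_killed _ nR a zs i.+1 M zsM.
have pA1 := ann_sub_Ass h1 pA.
have h2 := @lc_addp_ann_sub_rev _ a1 y M (noetherian_colon_stable nR a1 y) i.+1
  (tors i si) (tors i.+1 (leqW si)).
exact: ann_sub_Ass h2 p pA1.
Qed.

Hypothesis wlM : forall a t, is_grade a M t ->
  weakly_laskerian (homm (quom a) (local_cohomology a t.+1 M)).

(** [k] only bounds i minus the grade, so that the induction hypothesis applies to any enlarged
    ideal, however much its grade has grown. *)
Lemma lc_Ass_finite_grade k a s i : {subset a <= m} -> maximal_regular_seq a M s ->
  is_grade a M (size s) -> (i <= size s + k)%N -> finite_set (Ass (H a i)).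
Proof.
elim: k a s i => [|k IH] a s i am sP gra ik; have [sa [ws _] _] := sP.
- have [low eq] := lc_regular ws sa; move: ik; rewrite addn0 leq_eqVlt => /orP[/eqP ->|/low no].
    apply: sub_finite_set eq _; apply: Ass_finite nR lR _ _.
    by apply: fin_gen_noeth => //; exact: fin_gen_quom.
  by rewrite (_ : Ass _ = set0) //; apply/seteqP; split=> // p /no.
have [lt|] := ltnP i (size s + k.+1); first by apply: (IH a s i am sP gra); rewrite addnS in lt.
move=> ge; have {ge ik}iE : i = (size s + k).+1 by apply/eqP; rewrite eqn_leq -addnS ik.
case: k IH iE => [|k] IH iE.
  (* The degree is one above the grade, where the weakly Laskerian hypothesis applies. *)
  rewrite iE addn0; apply: sub_finite_set (wlM gra (zero_sub _)) => p pA.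
  by apply: Ass_hom_quom => // x; exact: Ass_lc_mem pA.
have [|a' [aa' a'N Aa']] := @lc_Ass_raise a s (size s + k) am ws sa; first exact: leq_addr.
rewrite iE addnS; apply: sub_finite_set Aa' _.
have [a'm|a'm] := pselect {subset a' <= m}; last first.
  by rewrite (_ : Ass _ = set0) //; apply/seteqP; split=> // p /(Ass_lc_improper a'm).
have [s' [s'P grs']] := grade_exists nR lR fgM M0 grM dimM a'm.
apply: (IH a' s' _ a'm s'P grs').
(* The degree stays the same while the grade rises by at least one, which lowers the bound [k]. *)
suff ss' : (size s < size s')%N by rewrite !addnS !ltnS -addSn leq_add2r.
have fgN : noeth_mod (quom (seq_act M s)) by apply: fin_gen_noeth => //; exact: fin_gen_quom.
have /finite_seqP[ps psE] := Ass_finite nR lR fgN.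
have psA p : p \in ps -> Ass (quom (seq_act M s)) p by move=> pps; rewrite psE.
have [p /psA/AssP[]//|p /psA pA|r ra' rps] := prime_avoidance (I := a') (ps := ps).
  apply: contrapT => no; apply: (a'N p pA) => x xa; apply: contrapT => /negP xp.
  by apply: no; exists x.
have wr : weakly_regular M (rcons s r).
  apply/weakly_regular_rcons; split=> //; apply: contrapT => /(zerodivisor_Ass nR lR)[p [pA rp]].
  by have : p \in ps by [move: pA; rewrite psE]; move=> /rps; rewrite rp.
rewrite -(size_rcons s r).
apply: (maximal_regular_size nR lR fgM M0 grM dimM a'm s'P wr) => x.
by rewrite mem_rcons inE => /orP[/eqP ->//|/sa /aa'].
Qed.

End MainInduction.

Theorem theorem3p7 (R : comNzRingType) (m : ideal R) (M : lmodType R)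
  (noethR : noetherian_ring R) (localR : local_ring m)
  (cmM : cohen_macaulay m M)
  (wlM : forall (a : ideal R) (t : nat), is_grade a M t ->
     weakly_laskerian (homm (quom a) (local_cohomology a t.+1 M))) :
  forall (a : ideal R) (i : nat), finite_set (Ass (local_cohomology a i M)).
Proof.
move=> a i; have [fgM cm] := cmM.
have empty : (forall p, ~ Ass (local_cohomology a i M) p) -> finite_set (Ass (local_cohomology a i M)).
  by move=> no; rewrite (_ : Ass _ = set0) //; apply/seteqP; split=> // p /no.
have [M0|M0] := pselect (exists x : M, x != 0); last first.
  (* For M = 0 there is no dimension to work with, but every class is killed by 1. *)
  apply: empty => p /AssP[pp [xi xip]]; move/negP: (prime_1 pp); apply; apply/xip.
  apply: lc_killed => x; rewrite scale1r; apply: contrapT => /eqP x0; apply: M0; by exists x.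
have [am|am] := pselect {subset a <= m}; last first.
  by apply: empty => p; exact: (Ass_lc_improper noethR localR am).
have [d [grM dimM]] := cm M0.
have [s [sP gra]] := grade_exists noethR localR fgM M0 grM dimM am.
exact: (@lc_Ass_finite_grade R m M noethR localR fgM M0 d grM dimM wlM i a s i am sP gra (leq_addl _ _)).
Qed.
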